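(* Let $\mathscr{V}\subseteq\mathfrak{B}(\mathcal{H})$ be a linear subspace containing a positive definite operator $V$, and let $\sigma:=\Pi_{\mathcal{Z}({\rm alg}(\mathscr{V}))}[V]$, where $\Pi_{\mathcal{Z}({\rm alg}(\mathscr{V}))}$ is the Hilbert–Schmidt orthogonal projection onto the center $\mathcal{Z}({\rm alg}(\mathscr{V}))$. Then $\sigma$ is positive definite, $\mathscr{V}\subseteq{\rm alg}_\sigma(\mathscr{V})$, $\sigma\sim{\rm alg}(\mathcal{D}_\sigma^{-1}(\mathscr{V}))$ (so that ${\rm alg}_\sigma(\mathscr{V})$ is the image of a state extension), and for every positive definite $\rho$ with $\rho\sim{\rm alg}(\mathcal{D}_\rho^{-1}(\mathscr{V}))$ one has $${\rm alg}_\sigma(\mathscr{V})\subseteq{\rm alg}_\rho(\mathscr{V}).$$ That is, ${\rm alg}_\sigma(\mathscr{V})$ is the minimal distorted algebra containing $\mathscr{V}$ that admits a state extension.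
   Context: $\mathcal{H}$ finite-dimensional complex Hilbert space, $\mathfrak{B}(\mathcal{H})$ its linear operators, $\langle X,Y\rangle_{HS}={\rm tr}(X^\dagger Y)$. A $*$-algebra is a linear subspace of $\mathfrak{B}(\mathcal{H})$ closed under products and adjoints; ${\rm alg}(\mathcal{S})$ is the smallest $*$-algebra containing $\mathcal{S}$. Commutant $\mathscr{A}'=\{X:[X,A]=0\ \forall A\in\mathscr{A}\}$, center $\mathcal{Z}(\mathscr{A})=\mathscr{A}\cap\mathscr{A}'$. For positive definite $\rho$, $\mathcal{D}_\rho(X)=\rho^{1/2}X\rho^{1/2}$, $\mathcal{D}_\rho^{-1}(X)=\rho^{-1/2}X\rho^{-1/2}$. A $\rho$-distorted algebra is a linear subspace closed under adjoints and the product $X\cdot_\rho Y=X\rho^{-1}Y$; ${\rm alg}_\rho(\mathcal{S})$ is the smallest one containing $\mathcal{S}$. Wedderburn decomposition of a unital $*$-algebra $\mathscr{A}$: unitary $U$, $\mathcal{H}\cong\bigoplus_l\mathcal{H}_{S,l}\otimes\mathcal{H}_{F,l}$, $\mathscr{A}=U(\bigoplus_l\mathfrak{B}(\mathcal{H}_{S,l})\otimes I_{F,l})U^\dagger$. Compatibility: $\rho\sim\mathscr{A}$ if for some Wedderburn decomposition of $\mathscr{A}$, $\rho=U(\bigoplus_l\rho_{S,l}\otimes\tau_{F,l})U^\dagger$ with $\rho_{S,l}\in\mathfrak{B}(\mathcal{H}_{S,l})$, $\tau_{F,l}\in\mathfrak{B}(\mathcal{H}_{F,l})$. A conditional expectation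 onto a unital $*$-algebra $\mathscr{A}$ is a CP unital map $\mathbb{E}:\mathfrak{B}(\mathcal{H})\to\mathscr{A}$ with $\mathbb{E}(AB)=A\mathbb{E}(B)$ for $A\in\mathscr{A}$; its state extension is the Hilbert–Schmidt adjoint $\mathbb{E}^\dagger$. A distorted algebra $\mathcal{D}_\rho(\mathscr{A})$ admits a state extension if there is a conditional expectation onto $\mathscr{A}$ whose state extension has image $\mathcal{D}_\rho(\mathscr{A})$ (for positive definite $\rho$ and unital $\mathscr{A}$ this holds iff $\rho\sim\mathscr{A}$). *)

(* Defs.v *)
From HB Require Import structures.
From Stdlib Require Import ClassicalEpsilon.
From mathcomp Require Import all_boot all_order all_algebra.
From mathcomp Require Import sesquilinear spectral.
From mathcomp Require Import complex.
From mathcomp Require Import reals.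

Set Implicit Arguments.
Unset Strict Implicit.
Unset Printing Implicit Defensive.

Import Order.TTheory GRing.Theory Num.Theory.
Local Open Scope ring_scope.
Local Open Scope sesquilinear_scope.

(* Operators on an n-dimensional complex Hilbert space = 'M[C]_n, with
   C = R[i] for R : realType (i.e. C is the field of complex numbers). *)

Section Defs.
Variables (C : numClosedFieldType) (n : nat).
Local Notation M := 'M[C]_n.

(* subsets of B(H) *)
Definition mxset := M -> Prop.
Definition mxsubset (S T : mxset) := forall X, S X -> T X.

(* Hermitian adjoint *)
Definition adj (A : M) : M := A ^t*.

(* Hilbert--Schmidt inner product <X,Y> = tr(X^dag Y) *)
Definition hs (X Y : M) : C := \tr (adj X *m Y).

Definition subspace (S : mxset) :=
  [/\ S 0, (forall X Y, S X -> S Y -> S (X + Y))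
     & (forall (a : C) X, S X -> S (a *: X))].

(* *-algebra: linear subspace closed under products and adjoints *)
Definition star_algebra (S : mxset) :=
  [/\ subspace S, (forall X Y, S X -> S Y -> S (X *m Y))
     & (forall X, S X -> S (adj X))].

(* alg(S): smallest *-algebra containing S *)
Definition alg (S : mxset) : mxset :=
  fun X => forall A, star_algebra A -> mxsubset S A -> A X.

(* positive definite operators *)
Definition posdef (A : M) :=
  adj A = A /\ forall v : 'rV[C]_n, v != 0 -> 0 < (v *m A *m v ^t*) 0 0.

(* the (unique) positive definite square root of a positive definite rho *)
Definition sqrtm (rho : M) : M :=
  epsilon (inhabits rho) (fun S => posdef S /\ S *m S = rho).

(* D_rho(X) = rho^{1/2} X rho^{1/2},  D_rho^{-1}(X) = rho^{-1/2} X rho^{-1/2} *)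
Definition Drho (rho X : M) : M := sqrtm rho *m X *m sqrtm rho.
Definition Drho_inv (rho X : M) : M :=
  invmx (sqrtm rho) *m X *m invmx (sqrtm rho).
Definition Drho_inv_set (rho : M) (S : mxset) : mxset :=
  fun Y => exists2 X, S X & Y = Drho_inv rho X.

(* rho-distorted product X .rho Y = X rho^{-1} Y *)
Definition dprod (rho X Y : M) : M := X *m invmx rho *m Y.

(* rho-distorted algebra *)
Definition distorted_algebra (rho : M) (S : mxset) :=
  [/\ subspace S, (forall X Y, S X -> S Y -> S (dprod rho X Y))
     & (forall X, S X -> S (adj X))].

(* alg_rho(S): smallest rho-distorted algebra containing S *)
Definition alg_rho (rho : M) (S : mxset) : mxset :=
  fun X => forall A, distorted_algebra rho A -> mxsubset S A -> A X.

(* commutant and center *)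
Definition commutant (A : mxset) : mxset :=
  fun X => forall Y, A Y -> X *m Y = Y *m X.
Definition center (A : mxset) : mxset := fun X => A X /\ commutant A X.

(* Hilbert--Schmidt orthogonal projection of V onto the subspace S *)
Definition HSproj (S : mxset) (V : M) : M :=
  epsilon (inhabits V) (fun P => S P /\ forall Y, S Y -> hs Y (V - P) = 0).

(* Block operators w.r.t. a decomposition
   H = (+)_{l < k} H_{S,l} (x) H_{F,l}, dim H_{S,l} = s l, dim H_{F,l} = f l,
   where the basis vector p : 'I_n of H is identified via the bijection e
   with the triple (l, i, j), i < s l, j < f l.
   blockI e B    = (+)_l B_l (x) I_{F,l}
   blockT e R T  = (+)_l R_l (x) T_l
   (the block entries are given as functions of the nat indices). *)
Definition blockI (k : nat) (s f : 'I_k -> nat)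
    (e : 'I_n -> {l : 'I_k & ('I_(s l) * 'I_(f l))%type})
    (B : 'I_k -> nat -> nat -> C) : M :=
  \matrix_(p, q)
    (if tag (e p) == tag (e q) then
       B (tag (e p)) (tagged (e p)).1 (tagged (e q)).1 *
       (((tagged (e p)).2 : nat) == (tagged (e q)).2)%:R
     else 0).

Definition blockT (k : nat) (s f : 'I_k -> nat)
    (e : 'I_n -> {l : 'I_k & ('I_(s l) * 'I_(f l))%type})
    (Rs Ts : 'I_k -> nat -> nat -> C) : M :=
  \matrix_(p, q)
    (if tag (e p) == tag (e q) then
       Rs (tag (e p)) (tagged (e p)).1 (tagged (e q)).1 *
       Ts (tag (e p)) (tagged (e p)).2 (tagged (e q)).2
     else 0).

(* compatibility rho ~ A: for some Wedderburn decomposition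
   A = U ((+)_l B(H_{S,l}) (x) I_{F,l}) U^dag  of A, one has
   rho = U ((+)_l rho_{S,l} (x) tau_{F,l}) U^dag. *)
Definition compatible (rho : M) (A : mxset) :=
  exists (k : nat) (s f : 'I_k -> nat)
         (e : 'I_n -> {l : 'I_k & ('I_(s l) * 'I_(f l))%type}) (U : M),
    [/\ bijective e, U \is unitarymx,
        (forall X, A X <-> exists B, X = U *m blockI e B *m U ^t*)
      & exists Rs Ts, rho = U *m blockT e Rs Ts *m U ^t*].

End Defs.

(* Main.v *)
Require Import Defs.
From HB Require Import structures.
From Stdlib Require Import Classical ClassicalEpsilon.
From mathcomp Require Import all_boot all_order all_algebra.
From mathcomp Require Import sesquilinear spectral complex reals.

(* For a *-algebra A, the Hilbert-Schmidt complement in A of the span [A, A] of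
   the commutators is the center. Hence sigma, for A = alg(V), is the unique
   central element with V - sigma in [A, A]; unlike the orthogonal projection,
   this description is compatible with surjective *-homomorphisms.

   Positivity of sigma follows by testing against its spectral projections.
   Since sigma commutes with B = alg(D_sigma^-1(V)), the Wedderburn theorem for
   B gives sigma ~ B.

   For minimality, let rho ~ B = alg(D_rho^-1(V)) and S = rho^1/2. Everything
   reduces to S^-1 sigma S^-1 being in B, that is, by the bicommutant property
   of B, commuting with B'. As rho ~ B, the space B' is stable under
   T |-> rho T rho^-1, so it is spanned by T with S T = mu T S, mu > 0. Such T
   satisfy X T = mu^2 T X for all X in V, and the first paragraph applied to the
   algebra of pairs generated by the (X, mu^2 X) yields sigma T = mu^2 T sigma,
   which means that S^-1 sigma S^-1 commutes with T. *)

Set Implicit Arguments.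
Unset Strict Implicit.
Unset Printing Implicit Defensive.

Import Order.TTheory GRing.Theory Num.Theory.
Local Open Scope ring_scope.
Local Open Scope sesquilinear_scope.

(** * Adjoints and definiteness of the Hilbert-Schmidt product *)

Section Adjoint.
Variable C : numClosedFieldType.

Lemma trmxC_mul m n p (A : 'M[C]_(m, n)) (B : 'M[C]_(n, p)) :
  (A *m B) ^t* = B ^t* *m A ^t*.
Proof. by rewrite trmx_mul map_mxM. Qed.

Lemma mul_trmxC_diag_ge0 m n (A : 'M[C]_(m, n)) i :
  0 <= (A *m A ^t*) i i.
Proof. by rewrite mxE sumr_ge0 // => j _; rewrite !mxE mul_conjC_ge0. Qed.

Lemma mul_trmxC_eq0 m n (A : 'M[C]_(m, n)) : A *m A ^t* = 0 -> A = 0.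
Proof.
move=> /matrixP A0; apply/matrixP => i j; have /eqP := A0 i i; rewrite !mxE.
rewrite psumr_eq0 => [/allP/(_ j)|k _]; last by rewrite !mxE mul_conjC_ge0.
by rewrite mem_index_enum !mxE mul_conjC_eq0 => /(_ isT)/eqP.
Qed.

Variable n : nat.
Implicit Types A B : 'M[C]_n.

Lemma adjK A : adj (adj A) = A. Proof. exact: trmxCK. Qed.
Lemma adjM A B : adj (A *m B) = adj B *m adj A. Proof. exact: trmxC_mul. Qed.
Lemma adjD A B : adj (A + B) = adj A + adj B.
Proof. by rewrite /adj linearD map_mxD. Qed.
Lemma adjN A : adj (- A) = - adj A.
Proof. by rewrite /adj linearN map_mxN. Qed.
Lemma adjB A B : adj (A - B) = adj A - adj B.
Proof. by rewrite adjD adjN. Qed.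
Lemma adjZ a A : adj (a *: A) = a^* *: adj A.
Proof. by rewrite /adj linearZ map_mxZ. Qed.
Lemma adj0 : adj 0 = 0 :> 'M[C]_n.
Proof. by rewrite /adj trmx0 map_mx0. Qed.
Lemma adj1 : adj 1%:M = 1%:M :> 'M[C]_n.
Proof. by rewrite /adj trmx1 map_mx1. Qed.

Lemma hs_self_eq0 A : hs A A = 0 -> A = 0.
Proof.
have AA_ge0 i : 0 <= (adj A *m A) i i.
  by rewrite -{2}[A]adjK mul_trmxC_diag_ge0.
move=> /eqP; rewrite /hs /mxtrace psumr_eq0 // => /allP A0.
apply/matrixP => j i; have := A0 i (mem_index_enum _); rewrite mxE psumr_eq0.
  move=> /allP/(_ j (mem_index_enum _)).
  by rewrite !mxE mulrC mul_conjC_eq0 => /eqP.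
by move=> k _; rewrite !mxE mulrC mul_conjC_ge0.
Qed.

Lemma adj_invmx A : adj (invmx A) = invmx (adj A).
Proof. by rewrite /adj trmx_inv map_invmx. Qed.

Lemma herm_normal A : adj A = A -> A \is normalmx.
Proof. by move=> A_h; apply/normalmxP; rewrite -/(adj A) A_h. Qed.

End Adjoint.

(** * Functional calculus of normal matrices *)

Section FunctionalCalculus.
Variables (C : numClosedFieldType) (n : nat).
Local Notation M := 'M[C]_n.

(** Newton interpolation: a new point is handled by adding a multiple of the polynomial [w] that
    vanishes on the earlier ones. It lets any function on a finite spectrum be treated as a
    polynomial. *)
Lemma interpolation (s : seq C) (g : C -> C) :
  exists q : {poly C}, {in s, forall x, q.[x] = g x}.
Proof.
elim: s => [|a s [q qP]]; first by exists 0.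
have [a_s|a_s] := boolP (a \in s).
  by exists q => x; rewrite inE => /predU1P[->|]; apply: qP.
pose w := \prod_(b <- s) ('X - b%:P).
have wa : w.[a] != 0 by rewrite -/(root w a) root_prod_XsubC.
exists (q + ((g a - q.[a]) / w.[a]) *: w) => x; rewrite inE hornerD hornerZ.
case/predU1P => [->|x_s]; first by rewrite divfK // addrC subrK.
have /eqP -> : w.[x] == 0 by rewrite -/(root w x) root_prod_XsubC.
by rewrite mulr0 addr0 qP.
Qed.

Definition hfun (g : C -> C) (h : M) : M :=
  (spectralmx h) ^t* *m diag_mx (map_mx g (spectral_diag h)) *m spectralmx h.

Section Normal.
Variable h : M.
Hypothesis h_normal : h \is normalmx.
Let P := spectralmx h.
Let PPt : P *m P ^t* = 1%:M.
Proof. exact/unitarymxP/spectral_unitarymx. Qed.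
Let PtP : P ^t* *m P = 1%:M.
Proof. by apply: mulmx1C. Qed.

Lemma hfun_id : hfun id h = h.
Proof.
rewrite /hfun [map_mx id _]map_mx_id // -invmx_unitary ?spectral_unitarymx //.
exact/esym/orthomx_spectralP.
Qed.

Lemma hfunM g1 g2 : hfun g1 h *m hfun g2 h = hfun (fun x => g1 x * g2 x) h.
Proof.
rewrite /hfun -!/P !mulmxA -(mulmxA _ P) PPt mulmx1.
rewrite -(mulmxA (P ^t*)) mulmx_diag; congr (_ *m diag_mx _ *m _).
by apply/rowP => i; rewrite !mxE.
Qed.

Lemma hfunD g1 g2 : hfun g1 h + hfun g2 h = hfun (fun x => g1 x + g2 x) h.
Proof.
rewrite /hfun -mulmxDl -mulmxDr -raddfD; congr (_ *m diag_mx _ *m _).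
by apply/rowP => i; rewrite !mxE.
Qed.

Lemma hfunZ a g : a *: hfun g h = hfun (fun x => a * g x) h.
Proof.
rewrite /hfun scalemxAl scalemxAr -linearZ; congr (_ *m diag_mx _ *m _).
by apply/rowP => i; rewrite !mxE.
Qed.

Lemma hfun_eq g1 g2 :
  (forall i, g1 (spectral_diag h 0 i) = g2 (spectral_diag h 0 i)) ->
  hfun g1 h = hfun g2 h.
Proof.
move=> g12; congr (_ *m diag_mx _ *m _).
by apply/rowP => i; rewrite !mxE g12.
Qed.

Lemma hfun1 : hfun (fun=> 1) h = 1%:M.
Proof.
rewrite /hfun -/P (_ : map_mx _ (spectral_diag h) = const_mx 1).
  by rewrite diag_const_mx mulmx1.
by apply/rowP => i; rewrite !mxE.
Qed.

Lemma hfun0 : hfun (fun=> 0) h = 0.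
Proof. by rewrite -(mul0r 1) -hfunZ scale0r. Qed.

Lemma hfun_sum I (r : seq I) (g : I -> C -> C) :
  \sum_(i <- r) hfun (g i) h = hfun (fun x => \sum_(i <- r) g i x) h.
Proof.
elim: r => [|i r IHr].
  by rewrite big_nil -hfun0; apply: hfun_eq => j; rewrite big_nil.
by rewrite big_cons IHr hfunD; apply: hfun_eq => j; rewrite big_cons.
Qed.

Lemma adj_hfun g : adj (hfun g h) = hfun (fun x => (g x)^*) h.
Proof.
rewrite /adj /hfun !trmxC_mul trmxCK mulmxA tr_diag_mx map_diag_mx.
by congr (_ *m diag_mx _ *m _); apply/rowP => i; rewrite !mxE.
Qed.

Lemma mxtrace_hfun_mul g (A : M) :
  \tr (hfun g h *m A) =
  \sum_i g (spectral_diag h 0 i) * (row i P *m A *m (row i P) ^t*) 0 0.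
Proof.
rewrite /hfun -!mulmxA mxtrace_mulC -!mulmxA; apply: eq_bigr => i _.
rewrite mul_diag_mx mxE [map_mx g _ _ _]mxE -/P; congr (_ * _).
rewrite mulmxA -row_mul [LHS]mxE [RHS]mxE.
by apply: eq_bigr => j _; rewrite !mxE.
Qed.

(** As [g 0 = 0], on the spectrum [g] agrees with a polynomial without constant term, so [S] may
    lack the identity. *)
Lemma hfun_closed (S : mxset C n) g : subspace S ->
  (forall X Y, S X -> S Y -> S (X *m Y)) -> S h -> g 0 = 0 -> S (hfun g h).
Proof.
move=> [S0 SD SZ] SM Sh g0.
have Sq (q : {poly C}) : S (hfun (fun x => q.[x] * x) h).
  elim/poly_ind: q => [|q c IHq].
    rewrite (@hfun_eq _ (fun=> 0)) ?hfun0 // => i.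
    by rewrite horner0 mul0r.
  rewrite (@hfun_eq _ (fun x => q.[x] * x * x + c * x)).
    rewrite -(hfunD (fun x => q.[x] * x * x)) -(hfunM (fun x => q.[x] * x)).
    by rewrite -(hfunZ _ id) hfun_id; apply: SD; [apply: SM|apply: SZ].
  by move=> i; rewrite hornerMXaddC mulrDl.
pose s := [seq spectral_diag h 0 i | i <- enum 'I_n].
have [q qP] := interpolation s (fun x => g x / x).
rewrite (@hfun_eq _ (fun x => q.[x] * x)) // => i.
set x := spectral_diag h 0 i.
rewrite qP; last by apply: map_f; rewrite mem_enum.
by have [->|x0] := eqVneq x 0; rewrite ?mulr0 // divfK.
Qed.

Lemma hfun_closed_unital (S : mxset C n) g : subspace S ->
  (forall X Y, S X -> S Y -> S (X *m Y)) -> S h -> S 1%:M -> S (hfun g h).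
Proof.
move=> S_sub SM Sh S1; have [_ SD SZ] := S_sub.
rewrite (@hfun_eq _ (fun x => (g x - g 0) + g 0 * 1)); last first.
  by move=> i; rewrite mulr1 subrK.
rewrite -(hfunD (fun x => g x - g 0)) -(hfunZ _ (fun=> 1)) hfun1.
by apply: SD; [apply: hfun_closed; rewrite ?subrr|apply: SZ].
Qed.

Lemma hfun_inv : h \in unitmx -> hfun GRing.inv h = invmx h.
Proof.
move=> h_unit; apply: (can_inj (mulKmx h_unit)); rewrite mulmxV //.
rewrite -{1}hfun_id hfunM -hfun1; apply: hfun_eq => i; rewrite mulfV //.
apply: contraTneq h_unit => di0; apply/negP => h_unit.
(* A zero eigenvalue would put row [i] of [P] in the left kernel of [h]. *)
have : delta_mx 0 i *m P *m h = 0 :> 'rV_n.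
  rewrite -[X in _ *m X]hfun_id /hfun -/P !mulmxA -(mulmxA _ P) PPt mulmx1.
  rewrite -rowE; apply/rowP => j; rewrite !mxE big1 // => k _.
  by rewrite !mxE; case: eqP => [<-|]; rewrite ?di0 ?mulr0n ?mul0r.
move/(congr1 (mulmxr (invmx h *m P ^t*))); rewrite /= mul0mx !mulmxA mulmxK //.
rewrite -mulmxA PPt mulmx1 => /rowP/(_ i)/eqP.
by rewrite !mxE !eqxx oner_eq0.
Qed.

End Normal.
End FunctionalCalculus.

(** * Positive definite matrices and square roots *)

Section PositiveDefinite.
Variables (C : numClosedFieldType) (n : nat).
Local Notation M := 'M[C]_n.

Lemma posdef_unit (A : M) : posdef A -> A \in unitmx.
Proof.
move=> [_ A_pos]; rewrite -row_free_unit; apply: inj_row_free => v vA0.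
apply/eqP/negPn/negP => /A_pos.
by rewrite vA0 mul0mx mxE ltxx.
Qed.

Lemma row_spectralmx_neq0 (A : M) i : row i (spectralmx A) != 0.
Proof.
apply/negP => /eqP /(congr1 (fun v => v *m (spectralmx A) ^t*)).
rewrite -row_mul (unitarymxP (spectral_unitarymx A)) mul0mx.
by move=> /rowP/(_ i)/eqP; rewrite !mxE eqxx oner_eq0.
Qed.

Lemma posdef_spectral (A : M) i : posdef A -> 0 < spectral_diag A 0 i.
Proof.
move=> [A_h A_pos]; set P := spectralmx A.
have PPt : P *m P ^t* = 1%:M by apply/unitarymxP/spectral_unitarymx.
have := A_pos _ (row_spectralmx_neq0 A i).
rewrite -/P -{1}(hfun_id (herm_normal A_h)) /hfun -/P [map_mx id _]map_mx_id //.
rewrite rowE !mulmxA -[_ *m P *m P^t*]mulmxA PPt mulmx1 trmxC_mul mulmxA.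
rewrite -[_ *m P *m P^t*]mulmxA PPt mulmx1 -rowE -[_ ^t*]mul1mx.
rewrite mulmxA mulmx1 mxE (bigD1 i) //= big1 ?addr0.
  by rewrite !mxE !eqxx conjC1 mulr1 mulr1n.
by move=> j /negPf ji; rewrite !mxE ji andbF conjC0 mulr0.
Qed.

Lemma posdef_hfun (g : C -> C) (h : M) : h \is normalmx ->
  (forall i, 0 < g (spectral_diag h 0 i)) -> posdef (hfun g h).
Proof.
move=> h_n g_pos; split=> [|v v_neq0].
  rewrite adj_hfun; apply: hfun_eq => i.
  by apply: geC0_conj; apply: ltW.
have PPt : spectralmx h *m (spectralmx h) ^t* = 1%:M.
  by apply/unitarymxP/spectral_unitarymx.
pose w := v *m (spectralmx h) ^t*.
have /rV0Pn[i wi] : w != 0.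
  apply: contraNneq v_neq0 => w0.
  by rewrite -[v]mulmx1 -(mulmx1C PPt) mulmxA -/w w0 mul0mx.
rewrite /hfun !mulmxA -mulmxA -/w -[X in _ *m (X *m _)]trmxCK -trmxC_mul -/w.
clearbody w; rewrite mxE (bigD1 i) //= ltr_wpDr //.
  apply: sumr_ge0 => j _; rewrite mul_mx_diag !mxE mulrAC mulr_ge0 //.
    by rewrite mul_conjC_ge0.
  exact: ltW.
by rewrite mul_mx_diag !mxE mulrAC mulr_gt0 // mul_conjC_gt0.
Qed.

Lemma posdef1 : posdef (1%:M : M).
Proof.
rewrite -(hfun1 (0 : M)); apply: posdef_hfun => [|i]; last exact: ltr01.
by apply: herm_normal; rewrite adj0.
Qed.

(** The [epsilon] in [sqrtm] meets its specification because [hfun sqrtC rho] is a witness. *)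
Lemma sqrtmP (rho : M) : posdef rho ->
  posdef (sqrtm rho) /\ sqrtm rho *m sqrtm rho = rho.
Proof.
move=> rho_pd; have rho_n := herm_normal rho_pd.1.
apply: (epsilon_spec (inhabits rho) (fun S => posdef S /\ S *m S = rho)).
exists (hfun sqrtC rho); split.
  by apply: posdef_hfun => // i; rewrite sqrtC_gt0 posdef_spectral.
rewrite hfunM -[RHS](hfun_id rho_n); apply: hfun_eq => i.
by rewrite -expr2 sqrtCK.
Qed.

End PositiveDefinite.

(** * Hilbert-Schmidt projections, commutator spans and centers *)

Section HilbertSchmidt.
Variables (C : numClosedFieldType).

(** Any vector of [S] outside the current row space is added to it; the rank grows each time and is
    at most [m]. *)
Lemma subspace_rowspace m (S : 'rV[C]_m -> Prop) : S 0 ->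
  (forall u v, S u -> S v -> S (u + v)) ->
  (forall (a : C) v, S v -> S (a *: v)) ->
  exists Q : 'M[C]_m, forall v, S v <-> (v <= Q)%MS.
Proof.
move=> S0 SD SZ.
suff: forall (k : nat) (Q : 'M[C]_m),
    (m - \rank Q < k)%N -> (forall v, (v <= Q)%MS -> S v) ->
    exists Q' : 'M[C]_m, forall v, S v <-> (v <= Q')%MS.
  move/(_ m.+1 0); apply; first by rewrite mxrank0 subn0.
  by move=> v; rewrite submx0 => /eqP ->.
elim=> [//|k IHk] Q rkQ QS.
have [[v [Sv vQ]]|noV] := classic (exists v, S v /\ ~~ (v <= Q)%MS); last first.
  exists Q => v; split=> [Sv|]; last exact: QS.
  by apply/negPn/negP => vQ; apply: noV; exists v.
apply: (IHk (Q + v)%MS) => [|u /sub_addsmxP[[x y] /= ->]]; last first.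
  apply: SD; first by apply: QS; rewrite submxMl.
  by rewrite [y]mx11_scalar mul_scalar_mx; apply: SZ.
have ltQ : (\rank Q < \rank (Q + v)%MS)%N.
  apply: rank_ltmx; rewrite /ltmx addsmxSl /=.
  by apply: contra vQ; apply: submx_trans; rewrite addsmxSr.
apply: leq_trans (_ : (m - \rank Q)%N <= _)%N; last by rewrite -ltnS.
by apply: ltn_sub2l => //; apply: leq_trans ltQ (rank_leq_col _).
Qed.

Variable n : nat.
Local Notation M := 'M[C]_n.
Implicit Types X Y : M.

Lemma hsD Y X X' : hs Y (X + X') = hs Y X + hs Y X'.
Proof. by rewrite /hs mulmxDr linearD. Qed.
Lemma hsZ Y a X : hs Y (a *: X) = a * hs Y X.
Proof. by rewrite /hs -scalemxAr linearZ. Qed.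
Lemma hsB Y X X' : hs Y (X - X') = hs Y X - hs Y X'.
Proof. by rewrite hsD -scaleN1r hsZ mulN1r. Qed.

Lemma subspaceN (S : mxset C n) X : subspace S -> S X -> S (- X).
Proof. by move=> [_ _ SZ] SX; rewrite -scaleN1r; apply: SZ. Qed.

Lemma subspaceB (S : mxset C n) X Y : subspace S -> S X -> S Y -> S (X - Y).
Proof.
move=> S_sub SX SY; have [_ SD _] := S_sub.
by apply: SD => //; apply: subspaceN.
Qed.

Lemma hs_mxvec Y X : hs Y X = (mxvec X *m (mxvec Y) ^t*) 0 0.
Proof.
rewrite mxE (reindex (uncurry (@mxvec_index n n))) /=; last first.
  exact: curry_mxvec_bij.
rewrite /hs /mxtrace; under [LHS]eq_bigr do rewrite mxE.
rewrite exchange_big pair_bigA /=; apply: eq_bigr => -[i j] _ /=.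
by rewrite !mxE !mxvecE mulrC.
Qed.

Lemma HSprojP (S : mxset C n) V : subspace S ->
  S (HSproj S V) /\ forall Y, S Y -> hs Y (V - HSproj S V) = 0.
Proof.
move=> [S0 SD SZ].
apply: (epsilon_spec (inhabits V)
  (fun P => S P /\ forall Y, S Y -> hs Y (V - P) = 0)).
have [||a v|Q QP] := @subspace_rowspace _ (fun v => S (vec_mx v)).
- by rewrite linear0.
- by move=> u v Su Sv; rewrite linearD; apply: SD.
- by rewrite linearZ; apply: SZ.
pose W := schmidt (row_base Q).
have WW : W *m W ^t* = 1%:M.
  by apply/unitarymxP/schmidt_unitarymx/rank_leq_col.
have WQ : (W :=: Q)%MS.
  exact: eqmx_trans (eqmx_schmidt_free (row_base_free Q)) (eq_row_base Q).
(* The rows of [W] are an orthonormal basis of the flattened [S], so right multiplication by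
   [W ^t* *m W] projects onto it. *)
exists (vec_mx (mxvec V *m W ^t* *m W)); split.
  by apply/QP; rewrite -WQ submxMl.
move=> Y SY; have /submxP[y Yy] : (mxvec Y <= W)%MS.
  by rewrite WQ; apply/QP; rewrite mxvecK.
rewrite hs_mxvec Yy [mxvec (_ - _)]raddfB /= vec_mxK trmxC_mul mulmxA mulmxBl.
by rewrite -[_ *m W *m _]mulmxA WW mulmx1 subrr mul0mx mxE.
Qed.

(** The linear span [A, A], encoded as an intersection of subspaces so that membership is itself an
    induction principle. *)
Definition commspan (A : mxset C n) : mxset C n := fun X =>
  forall S : mxset C n, subspace S ->
    (forall a b, A a -> A b -> S (a *m b - b *m a)) -> S X.

Lemma commspan_subspace (A : mxset C n) : subspace (commspan A).
Proof.
split=> [S [] //|X Y KX KY S S_sub SA|a X KX S S_sub SA];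
  have [S0 SD SZ] := S_sub.
- by apply: SD; [apply: KX|apply: KY].
- by apply: SZ; apply: KX.
Qed.

Lemma commspan_comm (A : mxset C n) a b :
  A a -> A b -> commspan A (a *m b - b *m a).
Proof. by move=> Aa Ab S _; apply. Qed.

Section StarAlgebra.
Variable A : mxset C n.
Hypothesis A_star : star_algebra A.

Lemma commspan_sub : mxsubset (commspan A) A.
Proof.
have [A_sub AM _] := A_star.
by move=> X; apply=> // a b Aa Ab; apply: subspaceB => //; apply: AM.
Qed.

Lemma commspan_adj X : commspan A X -> commspan A (adj X).
Proof.
have [A_sub AM Aadj] := A_star => KX.
apply: (KX (fun Y => commspan A (adj Y))) => [|a b Aa Ab].
  have [K0 KD KZ] := commspan_subspace A.
  split=> [|Y Z KY KZ'|a Y KY]; rewrite ?adj0 ?adjD ?adjZ //.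
  - exact: KD.
  - exact: KZ.
by rewrite adjB !adjM; apply: commspan_comm; apply: Aadj.
Qed.

Lemma center_subspace : subspace (center A).
Proof.
have [[A0 AD AZ] AM _] := A_star.
split=> [|X Y [AX cX] [AY cY]|a X [AX cX]].
- by split=> // Z _; rewrite mul0mx mulmx0.
- split=> [|Z AZ']; first exact: AD.
  by rewrite mulmxDl mulmxDr cX // cY.
- split=> [|Z AZ']; first exact: AZ.
  by rewrite -scalemxAl -scalemxAr cX.
Qed.

Lemma center_adj X : center A X -> center A (adj X).
Proof.
have [_ _ Aadj] := A_star => -[AX cX]; split=> [|Y AY]; first exact: Aadj.
by apply: (can_inj (@adjK _ _)); rewrite !adjM !adjK cX //; apply: Aadj.
Qed.

Lemma center_mul X Y : center A X -> center A Y -> center A (X *m Y).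
Proof.
have [_ AM _] := A_star => -[AX cX] [AY cY]; split=> [|Z AZ]; first exact: AM.
by rewrite -mulmxA cY // mulmxA cX // mulmxA.
Qed.

(** Cyclicity of the trace: tr(Z' [a, b]) = 0 whenever Z' = [adj Z] commutes with [a]. *)
Lemma center_orth_commspan Z X : center A Z -> commspan A X -> hs Z X = 0.
Proof.
move=> /center_adj[_ cZ] KX; apply: (KX (fun Y => hs Z Y = 0)) => [|a b Aa Ab].
  split=> [|Y Y' hY hY'|a Y hY]; first by rewrite /hs mulmx0 mxtrace0.
  - by rewrite hsD hY hY' addr0.
  - by rewrite hsZ hY mulr0.
rewrite hsB /hs [adj Z *m (b *m a)]mulmxA [\tr (_ *m a)]mxtrace_mulC.
by rewrite !mulmxA cZ // subrr.
Qed.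

(** With [w] the projection of [v] onto [A, A], the remainder [v - w] is orthogonal to all
    commutators, and this forces it to be central. *)
Lemma center_decomp v : A v -> exists2 z, center A z & commspan A (v - z).
Proof.
have [A_sub AM Aadj] := A_star => Av.
have [Kw w_orth] := HSprojP v (commspan_subspace A).
move: (HSproj _ _) Kw w_orth => w Kw w_orth.
exists (v - w); last by rewrite opprB addrC subrK.
have Ay : A (v - w) by apply: subspaceB => //; apply: commspan_sub.
split=> // c Ac; apply/eqP; rewrite -subr_eq0 -[_ - _]opprB oppr_eq0; apply/eqP.
set b := _ - _; have Ab : A b by apply: subspaceB => //; apply: AM.
(* Here [b] is the commutator of [c] with [v - w]. Moving [c] across the product turns [hs b b] into
   the pairing of the commutator of [adj c] and [b] with [v - w], which is 0. *)
apply: hs_self_eq0; rewrite -(w_orth (adj c *m b - b *m adj c)); last first.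
  by apply: commspan_comm => //; apply: Aadj.
rewrite {2}/hs adjB !adjM adjK mulmxBl linearB /= {2 3}/b.
rewrite /hs mulmxBr linearB /= !mulmxA; congr (_ - _).
by rewrite mxtrace_mulC !mulmxA.
Qed.

(** The difference [z - z'] is both central and in [A, A], hence orthogonal to itself. *)
Lemma center_decomp_uniq v z z' : center A z -> commspan A (v - z) ->
  center A z' -> commspan A (v - z') -> z = z'.
Proof.
move=> Zz Kz Zz' Kz'; apply/eqP; rewrite -subr_eq0; apply/eqP/hs_self_eq0.
apply: center_orth_commspan; first exact: subspaceB center_subspace _ _.
rewrite (_ : z - z' = (v - z') - (v - z)); last first.
  by rewrite opprB [RHS]addrC addrA subrK.
exact: subspaceB (commspan_subspace A) _ _.
Qed.

(** The central part given by [center_decomp] differs from [v] by an element orthogonal to the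
    center, so it is the orthogonal projection. *)
Lemma HSproj_center v : A v ->
  center A (HSproj (center A) v) /\ commspan A (v - HSproj (center A) v).
Proof.
move=> Av; have [Zs s_orth] := HSprojP v center_subspace.
move: (HSproj _ _) Zs s_orth => s Zs s_orth; split=> //.
have [z Zz Kz] := center_decomp Av; suff -> : s = z by [].
apply/eqP; rewrite -subr_eq0; apply/eqP/hs_self_eq0.
have Zsz : center A (s - z) by apply: subspaceB center_subspace _ _.
rewrite {2}(_ : s - z = (v - z) - (v - s)); last first.
  by rewrite opprB [RHS]addrC addrA subrK.
by rewrite hsB s_orth // subr0; apply: center_orth_commspan.
Qed.

(** Inversion fixes 0 by convention, so [hfun_closed] applies before the identity is known to be in
    [A]. *)
Lemma herm_invmx_closed h : adj h = h -> h \in unitmx -> A h -> A (invmx h).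
Proof.
move=> h_h h_unit Ah; have [A_sub AM _] := A_star.
rewrite -hfun_inv //; last exact: herm_normal.
by apply: hfun_closed; rewrite ?invr0 //; apply: herm_normal.
Qed.

Lemma star_algebra_unital h : adj h = h -> h \in unitmx -> A h -> A 1%:M.
Proof.
move=> h_h h_unit Ah; have [_ AM _] := A_star.
by rewrite -(mulmxV h_unit); apply/AM/herm_invmx_closed.
Qed.

End StarAlgebra.

Lemma alg_star (S : mxset C n) : star_algebra (alg S).
Proof.
split=> [|X Y aX aY|X aX]; first split=> [|X Y aX aY|a X aX].
all: move=> A A_star SA; have [[A0 AD AZ] AM Aadj] := A_star.
- by [].
- by apply: AD; [apply: aX|apply: aY].
- by apply: AZ; apply: aX.
- by apply: AM; [apply: aX|apply: aY].
- by apply: Aadj; apply: aX.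
Qed.

Lemma sub_alg (S : mxset C n) : mxsubset S (alg S).
Proof. by move=> X SX A _; apply. Qed.

End HilbertSchmidt.

(** * Positivity and intertwining of the center projection *)

Section CenterProjection.
Variables (C : numClosedFieldType) (n : nat).
Local Notation M := 'M[C]_n.
Variables (Vs : mxset C n) (V : M).
Hypothesis VsV : Vs V.
Local Notation A := (alg Vs).
Local Notation sigma := (HSproj (center A) V).

Let A_star : star_algebra A := alg_star Vs.
Let AV : A V := sub_alg VsV.

(** The adjoint of [sigma] is again a central part of [V], and central parts are unique. *)
Lemma HSproj_center_herm : adj V = V -> adj sigma = sigma.
Proof.
move=> V_h; have [Zs Ks] := HSproj_center A_star AV.
apply: (center_decomp_uniq A_star _ _ Zs Ks); first exact: center_adj.
by rewrite -V_h -adjB V_h; apply: commspan_adj.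
Qed.

Lemma HSproj_center_posdef : posdef V -> posdef sigma.
Proof.
move=> V_pd; have s_h := HSproj_center_herm V_pd.1.
have s_n := herm_normal s_h; have [_ AM _] := A_star.
have Z_sub := center_subspace A_star.
have [Zs s_orth] := HSprojP V Z_sub.
have A1 : A 1%:M := star_algebra_unital A_star V_pd.1 (posdef_unit V_pd) AV.
rewrite -[X in posdef X](hfun_id s_n); apply: posdef_hfun => // i.
set lam := spectral_diag _ 0 i.
(* The spectral projection of [sigma] at [lam]; being a polynomial in [sigma], it is central. *)
pose g (x : C) : C := (x == lam)%:R; pose E := hfun g sigma.
have ZE : center A E.
  apply: hfun_closed_unital => //; first exact: center_mul.
  by split=> // X _; rewrite mul1mx mulmx1.
have E_h : adj E = E.
  by rewrite adj_hfun; apply: hfun_eq => j; rewrite conjC_nat.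
have trE_gt0 B : posdef B -> 0 < \tr (E *m B).
  move=> [_ B_pos]; rewrite mxtrace_hfun_mul (bigD1 i) //= ltr_wpDr //.
    apply: sumr_ge0 => j _; rewrite mulr_ge0 ?ler0n //.
    by apply/ltW/B_pos/row_spectralmx_neq0.
  by rewrite /g eqxx mul1r; apply/B_pos/row_spectralmx_neq0.
have Es : E *m sigma = lam *: E.
  rewrite -[X in _ *m X](hfun_id s_n) hfunM // hfunZ; apply: hfun_eq => j.
  by rewrite /g; case: eqP => [->|]; rewrite ?mul0r ?mulr0 // mul1r mulr1.
(* Orthogonality of [V - sigma] to [E] reads tr(E V) = lam tr(E), and both traces are positive. *)
have := s_orth _ ZE; rewrite /hs E_h mulmxBr Es linearB linearZ /= => /eqP.
rewrite subr_eq0 => /eqP EV; have := trE_gt0 _ V_pd.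
by rewrite EV pmulr_lgt0 // -[E]mulmx1; apply/trE_gt0/posdef1.
Qed.

(* The pairs [(a, b)] generated by the [(X, lam X)] intertwine with [T]. As the
   center projection is determined by the commutators, applied to this algebra
   of pairs it gives [(sigma, lam sigma)], which therefore intertwines too. *)
Lemma HSproj_center_intertwine (T : M) (lam : C) : lam != 0 ->
  (forall X, Vs X -> X *m T = lam *: (T *m X)) ->
  (forall X, Vs X -> adj T *m X = lam *: (X *m adj T)) ->
  sigma *m T = lam *: (T *m sigma).
Proof.
move=> lam0 XT TX; have [[A0 AD AZ] AM Aadj] := A_star.
pose dg (a b : M) : 'M[C]_(n + n) := block_mx a 0 0 b.
pose G := alg (fun Y => exists2 X, Vs X & Y = dg X (lam *: X)).
have dgD a b a' b' : dg a b + dg a' b' = dg (a + a') (b + b').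
  by rewrite /dg add_block_mx !addr0.
have dgZ c a b : c *: dg a b = dg (c *: a) (c *: b).
  by rewrite /dg scale_block_mx !scaler0.
have dgM a b a' b' : dg a b *m dg a' b' = dg (a *m a') (b *m b').
  by rewrite /dg mulmx_block !mulmx0 !mul0mx !addr0 !add0r.
have dg_adj a b : adj (dg a b) = dg (adj a) (adj b).
  by rewrite /adj /dg tr_block_mx map_block_mx !trmx0 !map_mx0.
have dgE a b a' b' : dg a b = dg a' b' -> a = a' /\ b = b'.
  by move/eq_block_mx => -[-> _ _ ->].
have dg0 : dg 0 0 = 0 by rewrite /dg block_mx0.
have G_star : star_algebra G by apply: alg_star.
have [[G0 GD GZ] GM Gadj] := G_star.
have GX X : Vs X -> G (dg X (lam *: X)) by move=> VsX; apply: sub_alg; exists X.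
(* The relation for [adj T] is carried along because taking adjoints exchanges it with the one for
   [T]; together they define a star algebra of pairs. *)
pose H Y := exists a b,
    [/\ Y = dg a b, A a, A b, a *m T = T *m b & adj T *m a = b *m adj T].
have GP Y : G Y -> H Y.
  move=> /(_ H); apply; last first.
    move=> _ [X VsX ->]; exists X, (lam *: X).
    have AX : A X by apply: sub_alg.
    split=> //; first exact: AZ.
    - by rewrite -scalemxAr XT.
    - by rewrite -scalemxAl TX.
  split; first split.
  - by exists 0, 0; rewrite !mulmx0 !mul0mx.
  - move=> _ _ [a [b [-> Aa Ab e1 e2]]] [a' [b' [-> Aa' Ab' e1' e2']]].
    exists (a + a'), (b + b'); split; rewrite ?dgD //; try exact: AD.
    + by rewrite mulmxDl mulmxDr e1 e1'.
    + by rewrite mulmxDl mulmxDr e2 e2'.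
  - move=> c _ [a [b [-> Aa Ab e1 e2]]].
    exists (c *: a), (c *: b); split; rewrite ?dgZ //; try exact: AZ.
    + by rewrite -scalemxAl -scalemxAr e1.
    + by rewrite -scalemxAl -scalemxAr e2.
  - move=> _ _ [a [b [-> Aa Ab e1 e2]]] [a' [b' [-> Aa' Ab' e1' e2']]].
    exists (a *m a'), (b *m b'); split; rewrite ?dgM //; try exact: AM.
    + by rewrite -mulmxA e1' mulmxA e1 -mulmxA.
    + by rewrite mulmxA e2 -mulmxA e2' mulmxA.
  - move=> _ [a [b [-> Aa Ab e1 e2]]].
    exists (adj a), (adj b); split; rewrite ?dg_adj //; try exact: Aadj.
    + by rewrite -[T]adjK -!adjM e2.
    + by rewrite -!adjM e1.
(* Both coordinate maps from [G] to [A] are onto, the second since [lam] is nonzero; hence a central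
   pair has central coordinates. *)
have AG1 a0 : A a0 -> exists b, G (dg a0 b).
  move=> /(_ (fun a => exists b, G (dg a b))); apply; last first.
    by move=> X VsX; exists (lam *: X); apply: GX.
  split; first split.
  - by exists 0; rewrite dg0.
  - by move=> a a' [b Gb] [b' Gb']; exists (b + b'); rewrite -dgD; apply: GD.
  - by move=> c a [b Gb]; exists (c *: b); rewrite -dgZ; apply: GZ.
  - by move=> a a' [b Gb] [b' Gb']; exists (b *m b'); rewrite -dgM; apply: GM.
  - by move=> a [b Gb]; exists (adj b); rewrite -dg_adj; apply: Gadj.
have AG2 b0 : A b0 -> exists a, G (dg a b0).
  move=> /(_ (fun b => exists a, G (dg a b))); apply; last first.
    move=> X VsX; exists (lam^-1 *: X).
    by rewrite -[X in dg _ X](scalerK lam0) -dgZ; apply: GZ; apply: GX.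
  split; first split.
  - by exists 0; rewrite dg0.
  - by move=> b b' [a Ga] [a' Ga']; exists (a + a'); rewrite -dgD; apply: GD.
  - by move=> c b [a Ga]; exists (c *: a); rewrite -dgZ; apply: GZ.
  - by move=> b b' [a Ga] [a' Ga']; exists (a *m a'); rewrite -dgM; apply: GM.
  - by move=> b [a Ga]; exists (adj a); rewrite -dg_adj; apply: Gadj.
have [z [Gz cz] Kz] := center_decomp G_star (GX _ VsV).
have [a [b [zE Aa Ab aTb _]]] := GP _ Gz.
(* The coordinates of a commutator of pairs are commutators in [A]. *)
pose KK w := exists w1 w2, [/\ w = dg w1 w2, commspan A w1 & commspan A w2].
have KP w : commspan G w -> KK w.
  have [K0 KD KZ] := commspan_subspace A.
  move=> /(_ KK); apply=> [|_ _
    /GP[x [y [-> Ax Ay _ _]]] /GP[x' [y' [-> Ax' Ay' _ _]]]].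
    split.
    - by exists 0, 0.
    - move=> _ _ [x [y [-> Kx Ky]]] [x' [y' [-> Kx' Ky']]].
      by exists (x + x'), (y + y'); split; rewrite ?dgD //; apply: KD.
    - move=> c _ [x [y [-> Kx Ky]]].
      by exists (c *: x), (c *: y); split; rewrite ?dgZ //; apply: KZ.
  exists (x *m x' - x' *m x), (y *m y' - y' *m y).
  split; try exact: commspan_comm.
  by rewrite !dgM -[- dg _ _]scaleN1r dgZ dgD !scaleN1r.
have [w1 [w2 [wE Kw1 Kw2]]] := KP _ Kz.
have [w1E w2E] : V - a = w1 /\ lam *: V - b = w2.
  by apply: dgE; rewrite -wE zE -[- dg _ _]scaleN1r dgZ dgD !scaleN1r.
have [Zs Ks] := HSproj_center A_star AV.
have aE : a = sigma.
  apply: (center_decomp_uniq A_star _ _ Zs Ks); last by rewrite w1E.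
  by split=> // a' /AG1[b' /cz]; rewrite zE !dgM => /dgE[].
have bE : b = lam *: sigma.
  rewrite -[b](scalerKV lam0); congr (_ *: _).
  apply: (center_decomp_uniq A_star _ _ Zs Ks).
    split=> [|b' /AG2[a' /cz]]; first exact: AZ.
    by rewrite zE !dgM => /dgE[_ bb']; rewrite -scalemxAl -scalemxAr bb'.
  have [_ _ KZ] := commspan_subspace A.
  rewrite -[X in X - _](scalerK lam0) -scalerBr w2E.
  exact: KZ.
by rewrite -aE aTb bE -scalemxAr aE.
Qed.

End CenterProjection.

(** * Eigenvectors of conjugation by a positive definite matrix *)

Section Modular.
Variables (C : numClosedFieldType) (n : nat).
Local Notation M := 'M[C]_n.

(** Schur multiplication by [E] in the basis of the rows of [P]. In an eigenbasis of [rho],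
    conjugation by [rho] has this form, and changing the entries of [E] gives its functional
    calculus. *)
Definition schurm (P E T : M) : M :=
  P ^t* *m (\matrix_(i, j) (E i j * (P *m T *m P ^t*) i j)) *m P.

Section Schurm.
Variable P : M.
Hypothesis P_unitary : P \is unitarymx.
Let PPt : P *m P ^t* = 1%:M. Proof. exact/unitarymxP. Qed.
Let PtP : P ^t* *m P = 1%:M. Proof. exact: mulmx1C. Qed.

Lemma schurmK E T i j :
  (P *m schurm P E T *m P ^t*) i j = E i j * (P *m T *m P ^t*) i j.
Proof. by rewrite /schurm !mulmxA PPt mul1mx -mulmxA PPt mulmx1 mxE. Qed.

Lemma unitary_conj_inj (X Y : M) :
  (forall i j, (P *m X *m P ^t*) i j = (P *m Y *m P ^t*) i j) -> X = Y.
Proof.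
move=> XY; have /(congr1 (fun Z => P ^t* *m Z *m P)) :
  P *m X *m P ^t* = P *m Y *m P ^t* by apply/matrixP.
by rewrite !mulmxA PtP !mul1mx -!mulmxA PtP !mulmx1.
Qed.

(** Iterating the multiplier [D] and taking linear combinations gives all polynomials in its
    entries, and [g] is one of them on these finitely many entries. *)
Lemma schurm_closed (W : mxset C n) (D : M) g : subspace W ->
  (forall T, W T -> W (schurm P D T)) ->
  forall T, W T -> W (schurm P (map_mx g D) T).
Proof.
move=> [W0 WD WZ] W_D T WT.
pose s := [seq D ij.1 ij.2 | ij <- enum [set: 'I_n * 'I_n]].
have [q qP] := interpolation s g.
rewrite (_ : map_mx g D = map_mx (horner q) D); last first.
  apply/matrixP => i j; rewrite !mxE qP //; apply/mapP.
  by exists (i, j); rewrite ?mem_enum ?inE.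
elim/poly_ind: q {qP} => [|q c IHq].
  rewrite (_ : schurm _ _ _ = 0) //; apply: unitary_conj_inj => i j.
  by rewrite schurmK mulmx0 mul0mx !mxE horner0 mul0r.
have -> : schurm P (map_mx (horner (q * 'X + c%:P)) D) T =
    schurm P D (schurm P (map_mx (horner q) D) T) + c *: T.
  apply: unitary_conj_inj => i j.
  have -> X Y : (P *m (X + c *: Y) *m P ^t*) i j =
      (P *m X *m P ^t*) i j + c * (P *m Y *m P ^t*) i j.
    by rewrite mulmxDr mulmxDl -scalemxAr -scalemxAl mxE [X in _ + X = _]mxE.
  rewrite !schurmK 2![map_mx _ _ _ _]mxE.
  by rewrite hornerMXaddC mulrDl mulrA (mulrC q.[_]).
by apply: WD; [apply: W_D|apply: WZ].
Qed.

End Schurm.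

(* [rho T rho^-1] acts on [W] diagonalisably with positive eigenvalues, so [W]
   is spanned by eigenvectors, and these are also eigenvectors for [rho^1/2]. *)
Lemma modular_ind (S : M) (W Q : mxset C n) : posdef S ->
  subspace W -> subspace Q ->
  (forall T, W T -> W (S *m S *m T *m invmx (S *m S))) ->
  (forall mu T, 0 < mu -> W T -> S *m T = mu *: (T *m S) -> Q T) ->
  forall T, W T -> Q T.
Proof.
move=> S_pd W_sub [Q0 QD QZ] W_rho Q_hom T WT.
have S_n := herm_normal S_pd.1; have S_unit := posdef_unit S_pd.
pose P := spectralmx S; pose d i := spectral_diag S 0 i.
have P_u : P \is unitarymx by apply: spectral_unitarymx.
have PPt : P *m P ^t* = 1%:M by apply/unitarymxP.
have d_gt0 i : 0 < d i by apply: posdef_spectral.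
have d_neq0 i : d i != 0 by rewrite gt_eqF.
have PS : P *m S = diag_mx (spectral_diag S) *m P.
  rewrite -[X in _ *m X](hfun_id S_n) /hfun -/P [map_mx id _]map_mx_id //.
  by rewrite !mulmxA PPt mul1mx.
have SP : S *m P ^t* = P ^t* *m diag_mx (spectral_diag S).
  rewrite -[X in X *m _](hfun_id S_n) /hfun -/P [map_mx id _]map_mx_id //.
  by rewrite -!mulmxA PPt mulmx1.
have conjSl X i j : (P *m (S *m X) *m P ^t*) i j = d i * (P *m X *m P ^t*) i j.
  by rewrite mulmxA PS -!mulmxA mul_diag_mx mxE.
have conjSr X i j : (P *m (X *m S) *m P ^t*) i j = (P *m X *m P ^t*) i j * d j.
  by rewrite -!mulmxA SP !mulmxA mul_mx_diag mxE.
(* The eigenvalues of conjugation by [S *m S] on the matrix units of the eigenbasis. *)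
pose D : M := \matrix_(i, j) (d i / d j) ^+ 2.
have W_D X : W X -> W (schurm P D X).
  move/W_rho; congr W; apply: (unitary_conj_inj P_u) => i j.
  set Y := _ *m invmx _; have YE : Y *m S *m S = S *m (S *m X).
    by rewrite -mulmxA mulmxKV ?unitmx_mul ?S_unit // mulmxA.
  apply: (mulIf (d_neq0 j)); apply: (mulIf (d_neq0 j)).
  rewrite schurmK // -!conjSr YE !conjSl [D i j]mxE exprMn exprVn.
  by rewrite expr2 -!mulrA; congr (_ * (_ * _)); rewrite mulrCA -expr2 mulVf
    ?expf_neq0 ?mulr1.
pose F mu := schurm P (map_mx (fun x => (x == mu ^+ 2)%:R) D) T.
(* Positive ratios [d i / d j] are determined by their squares, so an eigencomponent for [S *m S] is
   one for [S]. *)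
have FE mu i j : 0 < mu ->
    (P *m F mu *m P ^t*) i j = (d i / d j == mu)%:R * (P *m T *m P ^t*) i j.
  by move=> mu0; rewrite schurmK // !mxE eqrXn2 // ?divr_ge0 ?ltW.
pose s := undup [seq d ij.1 / d ij.2 | ij <- enum [set: 'I_n * 'I_n]].
have s_gt0 mu : mu \in s -> 0 < mu.
  by rewrite mem_undup => /mapP[[i j] _ ->]; rewrite divr_gt0.
have -> : T = \sum_(mu <- s) F mu.
  apply: (unitary_conj_inj P_u) => i j.
  rewrite mulmx_sumr mulmx_suml summxE.
  rewrite (eq_big_seq (fun mu => (d i / d j == mu)%:R * (P *m T *m P ^t*) i j));
    last by move=> mu /s_gt0; apply: FE.
  rewrite (bigD1_seq (d i / d j)) ?undup_uniq //=; last first.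
    by rewrite mem_undup; apply/mapP; exists (i, j); rewrite ?mem_enum ?inE.
  rewrite eqxx mul1r big1 ?addr0 // => mu.
  by rewrite eq_sym => /negPf ->; rewrite mul0r.
rewrite big_seq; elim/big_ind: _ => // mu /s_gt0 mu_gt0.
apply: (Q_hom mu) => //; first exact: schurm_closed.
apply: (unitary_conj_inj P_u) => i j.
rewrite conjSl -scalemxAr -scalemxAl [RHS]mxE conjSr FE //.
have [<-|_] := eqVneq; last by rewrite !mul0r !mulr0.
by rewrite !mul1r [_ * d j]mulrC mulrA divfK.
Qed.

End Modular.

(** * Products and commutants of block operators *)

Section Blocks.
Variables (C : numClosedFieldType) (n k : nat) (s f : 'I_k -> nat).
Variable e : 'I_n -> {l : 'I_k & ('I_(s l) * 'I_(f l))%type}.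
Hypothesis e_bij : bijective e.
Implicit Types Rs Ts : 'I_k -> nat -> nat -> C.

Definition block_id : 'I_k -> nat -> nat -> C := fun _ a b => (a == b)%:R.

Lemma blockIE Rs : blockI e Rs = blockT e Rs block_id.
Proof. by apply/matrixP => p q; rewrite !mxE. Qed.

(** Block entries are functions on all of [nat]; only their values below the block sizes are
    read. *)
Lemma eq_blockT Rs Ts Rs' Ts' :
  (forall l (a b : 'I_(s l)), Rs l a b = Rs' l a b) ->
  (forall l (a b : 'I_(f l)), Ts l a b = Ts' l a b) ->
  blockT e Rs Ts = blockT e Rs' Ts'.
Proof.
move=> eqR eqT; apply/matrixP => p q; rewrite !mxE.
case: (e p) (e q) => [l [a b]] [l' [a' b']] /=.
by case: eqP => // ll'; case: _ / ll' in a' b' *; rewrite eqR eqT.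
Qed.

Lemma blockT_mul Rs Ts Rs' Ts' :
  blockT e Rs Ts *m blockT e Rs' Ts' =
  blockT e (fun l a b => \sum_(c < s l) Rs l a c * Rs' l c b)
           (fun l a b => \sum_(c < f l) Ts l a c * Ts' l c b).
Proof.
apply/matrixP => p q; rewrite !mxE.
pose F (x : {l : 'I_k & ('I_(s l) * 'I_(f l))%type}) :=
  (if tag (e p) == tag x then
     Rs (tag (e p)) (tagged (e p)).1 (tagged x).1 *
     Ts (tag (e p)) (tagged (e p)).2 (tagged x).2 else 0) *
  (if tag x == tag (e q) then
     Rs' (tag x) (tagged x).1 (tagged (e q)).1 *
     Ts' (tag x) (tagged x).2 (tagged (e q)).2 else 0).
(* The sum over basis vectors becomes one over triples; only block [l] contributes, and there it
   factors. *)
transitivity (\sum_x F x).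
  rewrite (reindex e) /=; last exact: onW_bij.
  by apply: eq_bigr => r _; rewrite !mxE.
rewrite /F {F}; case: (e p) (e q) => [l [a b]] [l' [a' b']] /=.
pose G (l0 : 'I_k) (x : ('I_(s l0) * 'I_(f l0))%type) :=
  (if l == l0 then Rs l a x.1 * Ts l b x.2 else 0) *
  (if l0 == l' then Rs' l0 x.1 a' * Ts' l0 x.2 b' else 0).
transitivity (\sum_l0 \sum_x G l0 x).
  by rewrite sig_big_dep; apply: eq_bigr => -[l0 x] _.
rewrite (bigD1 l) //= [X in _ + X]big1 ?addr0 => [|l0 /negPf l0l]; last first.
  by rewrite big1 // => x _; rewrite /G eq_sym l0l mul0r.
rewrite /G eqxx; case: eqP => ll'; last first.
  by rewrite big1 // => x _; rewrite mulr0.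
rewrite big_distrlr /= pair_bigA /=; apply: eq_bigr => x _.
by rewrite mulrACA.
Qed.

Lemma block_id_suml m (l : 'I_k) (a : 'I_m) (g : nat -> C) :
  \sum_(c < m) block_id l a c * g c = g a.
Proof.
rewrite (bigD1 a) //= /block_id eqxx mul1r big1 ?addr0 // => c.
by rewrite -val_eqE eq_sym => /negPf /= ->; rewrite mul0r.
Qed.

Lemma block_id_sumr m (l : 'I_k) (a : 'I_m) (g : nat -> C) :
  \sum_(c < m) g c * block_id l c a = g a.
Proof.
rewrite (bigD1 a) //= /block_id eqxx mulr1 big1 ?addr0 // => c.
by rewrite -val_eqE => /negPf /= ->; rewrite mulr0.
Qed.

Lemma blockT_factor Rs Ts :
  blockT e Rs block_id *m blockT e block_id Ts = blockT e Rs Ts.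
Proof.
rewrite blockT_mul; apply: eq_blockT => l a b; first exact: block_id_sumr.
by rewrite (block_id_suml _ _ (fun c => Ts l c b)).
Qed.

Lemma blockT_commute Rs Ts :
  blockT e block_id Ts *m blockT e Rs block_id = blockT e Rs Ts.
Proof.
rewrite blockT_mul; apply: eq_blockT => l a b; last exact: block_id_sumr.
by rewrite (block_id_suml _ _ (fun c => Rs l c b)).
Qed.

(** Commutation with the matrix units of the second factors kills the entries between different
    blocks and makes the others diagonal in the second index, with value independent of it. *)
Lemma block_commutant (Y : 'M[C]_n) :
  (forall Ts, Y *m blockT e block_id Ts = blockT e block_id Ts *m Y) ->
  exists Rs, Y = blockT e Rs block_id.
Proof.
move=> cY; have [e' eK e'K] := e_bij.
pose y l (x : 'I_(s l) * 'I_(f l)) l' (x' : 'I_(s l') * 'I_(f l')) : C :=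
  Y (e' (Tagged _ x)) (e' (Tagged _ x')).
(* The matrix unit at [(j, j')] of the second factor of block [l0], zero on the other blocks. *)
pose E (l0 : 'I_k) (j j' : nat) : 'I_k -> nat -> nat -> C :=
  fun l x y => [&& l == l0, x == j & y == j']%:R.
have YE l x l' a' (j j' : 'I_(f l')) :
    (Y *m blockT e block_id (E l' j j')) (e' (@Tagged _ l _ x))
      (e' (Tagged _ (a', j'))) = y l x l' (a', j).
  rewrite mxE (bigD1 (e' (Tagged _ (a', j)))) //= mxE !e'K /= eqxx.
  rewrite /block_id /E !eqxx !mulr1 big1 ?addr0 // => r r_neq.
  rewrite mxE !e'K /=; case er: (e r) => [l0 [a0 j0]] /=.
  case: eqP => [l0l|]; last by rewrite mulr0.
  case: _ / (esym l0l) in a0 j0 er *; rewrite eqxx /=.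
  have [a0a|] := eqVneq (a0 : nat) a'; last by rewrite mul0r mulr0.
  have [j0j|] := eqVneq (j0 : nat) j; last by rewrite mulr0 mulr0.
  case/eqP: r_neq; rewrite -[r]eK er; congr (e' (Tagged _ (_, _))).
  - exact: val_inj.
  - exact: val_inj.
have EY l a (j j' : 'I_(f l)) (b : 'I_(f l)) l' x' :
    (blockT e block_id (E l j j') *m Y) (e' (Tagged _ (a, b)))
      (e' (@Tagged _ l' _ x')) = (b == j)%:R * y l (a, j') l' x'.
  rewrite mxE (bigD1 (e' (Tagged _ (a, j')))) //= mxE !e'K /= eqxx.
  rewrite /block_id /E !eqxx andbT mul1r big1 ?addr0 // => r r_neq.
  rewrite mxE !e'K /=; case er: (e r) => [l0 [a0 j0]] /=.
  case: eqP => [l0l|]; last by rewrite mul0r.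
  case: _ / l0l in a0 j0 er *; rewrite eqxx /=.
  have [a0a|] := eqVneq (a : nat) a0; last by rewrite !mul0r.
  have [j0j|] := eqVneq (j0 : nat) j'; last by rewrite andbF mulr0 mul0r.
  case/eqP: r_neq; rewrite -[r]eK er; congr (e' (Tagged _ (_, _))).
  - exact/val_inj/esym.
  - exact: val_inj.
have EY0 l a b (l' : 'I_k) (j j' : nat) x' : l != l' ->
    (blockT e block_id (E l' j j') *m Y) (e' (@Tagged _ l _ (a, b)))
      (e' (@Tagged _ l' _ x')) = 0.
  move=> /negPf ll'; rewrite mxE big1 // => r _; rewrite mxE !e'K /= /E ll' /=.
  by case: ifP; rewrite ?mulr0 mul0r.
(* The common value is read at second index 0. The default covers indices out of range, including 0
   itself when [f l = 0] and the block is empty. *)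
pose Rs l (a a' : nat) : C :=
  if (insub a, insub a', insub 0%N) is
    (Some a0, Some a0', Some b0) then y l (a0, b0) l (a0', b0) else 0.
exists Rs; apply/matrixP => p q; rewrite -[p]eK -[q]eK mxE !e'K.
case: (e p) (e q) => [l [a b]] [l' [a' b']] /=.
rewrite -[LHS]/(y l (a, b) l' (a', b')) -(YE _ _ _ _ b' b') cY.
case: eqP => [ll'|/eqP]; last exact: EY0.
case: _ / ll' in a' b' *; rewrite EY /block_id val_eqE.
have [_|_] := eqVneq b b'; last by rewrite mul0r mulr0.
rewrite mul1r mulr1 /Rs !valK.
have f0 : (0 < f l)%N by apply: leq_ltn_trans (ltn_ord b').
rewrite insubT -(YE _ _ _ _ b' (Ordinal f0)) cY EY eqxx mul1r.
by congr (y l (_, _) l (_, _)); apply: val_inj.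
Qed.

End Blocks.

(** * Exchange of the tensor factors *)

Section BlockSwap.
Variables (C : numClosedFieldType) (n k : nat) (s f : 'I_k -> nat).
Variable e : 'I_n -> {l : 'I_k & ('I_(s l) * 'I_(f l))%type}.
Hypothesis e_bij : bijective e.

Definition swap_index (x : {l : 'I_k & ('I_(s l) * 'I_(f l))%type}) :
    {l : 'I_k & ('I_(f l) * 'I_(s l))%type} :=
  Tagged (fun l => ('I_(f l) * 'I_(s l))%type)
    ((tagged x).2, (tagged x).1).

Lemma blockT_swap (Rs Ts : 'I_k -> nat -> nat -> C) :
  blockT (swap_index \o e) Ts Rs = blockT e Rs Ts.
Proof.
by apply/matrixP => p q; rewrite !mxE /=; case: ifP => // _; rewrite mulrC.
Qed.

Lemma swap_index_bij : bijective (swap_index \o e).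
Proof.
apply: bij_comp e_bij.
exists (fun x => Tagged (fun l => ('I_(s l) * 'I_(f l))%type)
                   ((tagged x).2, (tagged x).1)).
- by case=> l [a b].
- by case=> l [a b].
Qed.

(** After exchanging the factors this is [block_commutant]. *)
Lemma blockI_commutant (Y : 'M[C]_n) :
  (forall B, Y *m blockI e B = blockI e B *m Y) ->
  exists Ts, Y = blockT e (@block_id C k) Ts.
Proof.
move=> cY; have [|Ts ->] := @block_commutant C _ _ _ _ _ swap_index_bij Y.
  by move=> Rs; rewrite blockT_swap -blockIE cY.
by exists Ts; rewrite blockT_swap.
Qed.

End BlockSwap.

(** * Consequences of compatibility, and minimality *)

Section Compatible.
Variables (C : numClosedFieldType) (n : nat).
Local Notation M := 'M[C]_n.

Lemma invmx_mul (X Y : M) : X \in unitmx -> Y \in unitmx ->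
  invmx (X *m Y) = invmx Y *m invmx X.
Proof.
move=> X_unit Y_unit; have XY_unit : X *m Y \in unitmx.
  by rewrite unitmx_mul X_unit.
by apply: (can_inj (mulKmx XY_unit)); rewrite mulmxV // mulmxA mulmxK // mulmxV.
Qed.

Lemma mulmx_unitary_conj (U X Y : M) : U \is unitarymx ->
  (U *m X *m U ^t*) *m (U *m Y *m U ^t*) = U *m (X *m Y) *m U ^t*.
Proof.
move=> /unitarymxP/mulmx1C UtU.
by rewrite !mulmxA -[_ *m U ^t* *m U]mulmxA UtU mulmx1.
Qed.

Lemma unitary_conjK (U X : M) : U \is unitarymx ->
  U *m (U ^t* *m X *m U) *m U ^t* = X.
Proof.
by move=> /unitarymxP UUt; rewrite !mulmxA UUt mul1mx -mulmxA UUt mulmx1.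
Qed.

Lemma unitary_conjVK (U X : M) : U \is unitarymx ->
  U ^t* *m (U *m X *m U ^t*) *m U = X.
Proof.
move=> /unitarymxP/mulmx1C UtU.
by rewrite !mulmxA UtU mul1mx -mulmxA UtU mulmx1.
Qed.

(** Compatibility factors [rho] as [t *m r] with [r] in [A] and [t] in its commutant. As [T]
    commutes with [r], conjugation by [rho] reduces to conjugation by [t], which preserves the
    commutant. *)
Lemma compatible_commutant (rho : M) (A : mxset C n) T :
  rho \in unitmx -> compatible rho A -> commutant A T ->
  commutant A (rho *m T *m invmx rho).
Proof.
move=> rho_unit [k [s [f [e [U [e_bij U_u AP [Rs [Ts rhoE]]]]]]]] cT Y AY.
pose r := U *m blockT e Rs (@block_id C k) *m U ^t*.
pose t := U *m blockT e (@block_id C k) Ts *m U ^t*.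
have trE : rho = t *m r by rewrite mulmx_unitary_conj ?blockT_commute.
have Ar : A r by apply/AP; exists Rs; rewrite blockIE.
have tY : t *m Y = Y *m t.
  case/AP: AY => B ->; rewrite blockIE !mulmx_unitary_conj //.
  by rewrite blockT_factor // blockT_commute.
have [t_unit r_unit] : t \in unitmx /\ r \in unitmx.
  by apply/andP; rewrite -unitmx_mul -trE.
clearbody r t.
have -> : rho *m T *m invmx rho = t *m T *m invmx t.
  apply: (can_inj (mulmxK rho_unit)); rewrite mulmxKV //= trE.
  by rewrite mulmxA mulmxKV // -!mulmxA -cT.
have tVY : invmx t *m Y = Y *m invmx t.
  apply: (can_inj (mulmxK t_unit)); rewrite mulmxKV // -mulmxA -tY.
  by rewrite mulKmx.
by rewrite -mulmxA tVY !mulmxA -(mulmxA t T) cT // mulmxA tY.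
Qed.

(** The operators acting on the second factors lie in the commutant, so [block_commutant] applies to
    what commutes with them. *)
Lemma compatible_bicommutant (rho : M) (A : mxset C n) :
  compatible rho A -> mxsubset (commutant (commutant A)) A.
Proof.
move=> [k [s [f [e [U [e_bij U_u AP _]]]]]] X ccX.
have [Ts|B YE] := @block_commutant _ _ _ _ _ _ e_bij (U ^t* *m X *m U);
  last first.
  by apply/AP; exists B; rewrite blockIE -YE unitary_conjK.
have /ccX : commutant A (U *m blockT e (@block_id C k) Ts *m U ^t*).
  move=> _ /AP[B ->]; rewrite blockIE !mulmx_unitary_conj //.
  by rewrite blockT_factor // blockT_commute.
rewrite -[X in X *m _](unitary_conjK _ U_u).
rewrite -[X in _ = _ *m X](unitary_conjK _ U_u).
rewrite !mulmx_unitary_conj // => /(congr1 (fun Z => U ^t* *m Z *m U)).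
by rewrite !unitary_conjVK.
Qed.

Lemma commutant_subspace (A : mxset C n) : subspace (commutant A).
Proof.
split=> [|X Y cX cY|a X cX] Z AZ.
- by rewrite mul0mx mulmx0.
- by rewrite mulmxDl mulmxDr cX // cY.
- by rewrite -scalemxAl -scalemxAr cX.
Qed.

Lemma commutant_adj (A : mxset C n) X :
  star_algebra A -> commutant A X -> commutant A (adj X).
Proof.
move=> [_ _ Aadj] cX Y AY.
by apply: (can_inj (@adjK _ _)); rewrite !adjM !adjK cX //; apply: Aadj.
Qed.

(** The map [X |-> S *m X *m S] turns the ordinary product into the [rho]-distorted one, so
    distorted algebras pull back to star algebras. *)
Lemma sandwich_alg_sub (S rho : M) (Vs : mxset C n) X : rho = S *m S ->
  S \in unitmx -> adj S = S ->
  alg (fun Y => exists2 X, Vs X & Y = invmx S *m X *m invmx S) X ->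
  alg_rho rho Vs (S *m X *m S).
Proof.
move=> -> S_unit S_h aX D [[D0 DD DZ] DM Dadj] VsD.
apply: (aX (fun X => D (S *m X *m S))) => [|_ [Y VsY ->]]; last first.
  by rewrite !mulmxA mulmxV // mul1mx mulmxKV //; apply: VsD.
split; first split.
- by rewrite mulmx0 mul0mx.
- by move=> Y Z DY DZ'; rewrite mulmxDr mulmxDl; apply: DD.
- by move=> a Y DY; rewrite -scalemxAr -scalemxAl; apply: DZ.
- move=> Y Z DY DZ'; have := DM _ _ DY DZ'; congr D.
  rewrite /dprod invmx_mul // !mulmxA.
  by rewrite mulmxK // -(mulmxA _ (invmx S)) mulVmx // mulmx1.
- by move=> Y /Dadj; rewrite !adjM S_h mulmxA.
Qed.

Lemma alg_sigma_minimal (Vs : mxset C n) (V : M) (rho : M) :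
  Vs V -> posdef V -> posdef rho ->
  compatible rho (alg (Drho_inv_set rho Vs)) ->
  mxsubset (alg_rho (HSproj (center (alg Vs)) V) Vs) (alg_rho rho Vs).
Proof.
move=> VsV V_pd rho_pd rho_comp.
set sigma := HSproj _ _; set B := alg (Drho_inv_set rho Vs).
have sigma_pd : posdef sigma by apply: HSproj_center_posdef.
have [S_pd SS] := sqrtmP rho_pd; set S := sqrtm rho in S_pd SS.
have S_unit := posdef_unit S_pd; have S_h := S_pd.1.
have SV_h : adj (invmx S) = invmx S by rewrite adj_invmx S_h.
have B_star : star_algebra B by apply: alg_star.
have [[B0 BD BZ] BM Badj] := B_star.
have VsB X : Vs X -> exists2 b, B b & X = S *m b *m S.
  move=> VsX; exists (Drho_inv rho X); first by apply: sub_alg; exists X.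
  by rewrite /Drho_inv -/S !mulmxA mulmxV // mul1mx mulmxKV.
pose h := invmx S *m sigma *m invmx S.
have h_h : adj h = h by rewrite !adjM SV_h sigma_pd.1 mulmxA.
have h_unit : h \in unitmx.
  by rewrite !unitmx_mul unitmx_inv S_unit posdef_unit.
have Bh : B h.
  apply: (compatible_bicommutant rho_comp).
  pose Q : mxset C n := fun T => h *m T = T *m h.
  apply: (@modular_ind _ _ S (commutant B) Q) => //.
  - exact: commutant_subspace.
  - split=> [|X Y QX QY|a X QX]; rewrite /Q ?mulmx0 ?mul0mx //.
      by rewrite mulmxDr mulmxDl QX QY.
    by rewrite -scalemxAr -scalemxAl QX.
  - move=> X; rewrite SS; apply: compatible_commutant => //.
    exact: posdef_unit.
  move=> mu T mu_gt0 cT ST.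
  have mu_neq0 : mu != 0 by rewrite gt_eqF.
  (* The adjoint of [ST]; the factor is unchanged because [mu] is real. *)
  have TS : adj T *m S = mu *: (S *m adj T).
    rewrite -{1}S_h -adjM ST adjZ adjM S_h geC0_conj //; exact: ltW.
  have cTt : commutant B (adj T) by apply: commutant_adj.
  (* Elements of [Vs] have the form [S *m b *m S] with [b] commuting with [T]; each [S] contributes
     one factor [mu]. *)
  have sT : sigma *m T = mu ^+ 2 *: (T *m sigma).
    apply: HSproj_center_intertwine => //; first by rewrite expf_neq0.
    + move=> X /VsB[b Bb ->].
      rewrite -mulmxA ST -scalemxAr !mulmxA -(mulmxA S b) -cT // mulmxA ST.
      by rewrite -!scalemxAl scalerA -expr2.
    + move=> X /VsB[b Bb ->].
      rewrite !mulmxA TS -!scalemxAl -(mulmxA S) cTt // -!mulmxA TS.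
      by rewrite -!scalemxAr scalerA -expr2.
  have SVT : invmx S *m T = mu^-1 *: (T *m invmx S).
    apply: (can_inj (mulKmx S_unit)); rewrite mulKVmx // -scalemxAr mulmxA ST.
    by rewrite -scalemxAl scalerA mulVf // scale1r mulmxK.
  rewrite /Q /h -mulmxA SVT -scalemxAr -(mulmxA _ sigma) (mulmxA sigma) sT.
  rewrite -scalemxAl -scalemxAr !mulmxA SVT -!scalemxAl !scalerA.
  by rewrite expr2 mulfK // mulVf // scale1r.
(* This is the inverse of [h]. Its membership makes [S B S] closed under the [sigma]-distorted
   product, so [S B S] contains [alg_rho sigma Vs]. *)
have Bh' : B (S *m invmx sigma *m S).
  have := herm_invmx_closed B_star h_h h_unit Bh; congr B.
  rewrite !invmx_mul ?unitmx_mul ?unitmx_inv ?S_unit ?posdef_unit //.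
  by rewrite !invmxK mulmxA.
move=> X aX; have {aX} [b Bb ->] : exists2 b, B b & X = S *m b *m S.
  apply: (aX (fun X => exists2 b, B b & X = S *m b *m S)) => //.
  split; first split.
  - by exists 0; rewrite // mulmx0 mul0mx.
  - move=> _ _ [b Bb ->] [b' Bb' ->]; exists (b + b'); first exact: BD.
    by rewrite mulmxDr mulmxDl.
  - move=> a _ [b Bb ->]; exists (a *: b); first exact: BZ.
    by rewrite -scalemxAr -scalemxAl.
  - move=> _ _ [b Bb ->] [b' Bb' ->].
    exists (b *m (S *m invmx sigma *m S) *m b').
      by apply: (BM) => //; apply: (BM).
    by rewrite /dprod !mulmxA.
  - move=> _ [b Bb ->]; exists (adj b); first exact: Badj.
    by rewrite !adjM S_h mulmxA.
exact: sandwich_alg_sub.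
Qed.

End Compatible.

(** * Minimal projections of a star algebra *)

Section MinimalProjections.
Variables (C : numClosedFieldType) (n : nat).
Local Notation M := 'M[C]_n.
Implicit Types p q h X : M.

(** With [Y = p *m X - X], expanding [Y *m adj Y] gives 0. *)
Lemma partial_isometry_range p X : p *m p = p -> X *m adj X = p -> p *m X = X.
Proof.
move=> pp XX; apply/eqP; rewrite -subr_eq0; apply/eqP/mul_trmxC_eq0.
have p_h : adj p = p by rewrite -XX adjM adjK.
rewrite -/(adj _) adjB adjM p_h mulmxBl !mulmxBr !mulmxA -(mulmxA p X) XX !pp.
by rewrite subrr.
Qed.

Definition orthoproj p := p *m p = p /\ adj p = p.

Lemma mxtrace_mul_adj_gt0 X : X != 0 -> 0 < \tr (X *m adj X).
Proof.
move=> X0; rewrite lt_def sumr_ge0 ?andbT; last first.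
  by move=> i _; apply: mul_trmxC_diag_ge0.
apply: contra_neq X0 => trX; rewrite -[X]adjK -[RHS]adj0; congr adj.
by apply: hs_self_eq0; rewrite /hs adjK.
Qed.

Lemma orthoproj_trace_gt0 p : orthoproj p -> p != 0 -> 0 < \tr p.
Proof. by move=> [pp p_h] /mxtrace_mul_adj_gt0; rewrite p_h pp. Qed.

Lemma orthoproj_rank_lt p q :
  q *m p = q -> p *m q = q -> q *m q = q -> q != p -> (\rank q < \rank p)%N.
Proof.
move=> qp pq qq qNp; apply: rank_ltmx; rewrite /ltmx -{1}qp submxMl /=.
apply: contra_neqN qNp => /submxP[x px].
by rewrite -pq {1}px -mulmxA qq -px.
Qed.

Lemma hfun_commute g h X : h \is normalmx ->
  X *m h = h *m X -> X *m hfun g h = hfun g h *m X.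
Proof.
move=> h_n Xh.
apply: (@hfun_closed_unital _ _ _ h_n (fun Y => X *m Y = Y *m X)).
- split=> [|Y Z XY XZ|a Y XY]; first by rewrite mulmx0 mul0mx.
    by rewrite mulmxDl mulmxDr XY XZ.
  by rewrite -scalemxAl -scalemxAr XY.
- by move=> Y Z XY XZ; rewrite mulmxA XY -mulmxA XZ mulmxA.
- by [].
- by rewrite mulmx1 mul1mx.
Qed.

Variable A : mxset C n.
Hypotheses (A_star : star_algebra A) (A1 : A 1%:M).

(** Minimality in the form of a scalar corner; [orthoproj_split] ties it to proper
    subprojections. *)
Definition minimal_in p := forall a, A a -> exists c, p *m a *m p = c *: p.

Lemma herm_corner p : A p -> orthoproj p -> ~ minimal_in p ->
  exists h, [/\ A h, adj h = h, h *m p = h, p *m h = h & forall c, h <> c *: p].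
Proof.
move=> Ap [pp p_h] p_nmin; have [A_sub AM Aadj] := A_star.
have [_ AD AZ] := A_sub.
apply: NNPP => no_h; apply: p_nmin => a Aa; set b := p *m a *m p.
have Ab : A b by apply: (AM) => //; apply: (AM).
have bp : b *m p = b by rewrite /b -mulmxA pp.
have pb : p *m b = b by rewrite /b !mulmxA pp.
have btp : adj b *m p = adj b by rewrite -{1}p_h -adjM pb.
have pbt : p *m adj b = adj b by rewrite -{1}p_h -adjM bp.
have scal h : A h -> adj h = h -> h *m p = h -> p *m h = h ->
    exists c, h = c *: p.
  move=> Ah h_h hp ph; apply: NNPP => no_c; apply: no_h; exists h; split=> //.
  by move=> c hc; apply: no_c; exists c.
have [||||c1 h1] := scal (b + adj b).
- by apply: AD => //; apply: Aadj.
- by rewrite adjD adjK addrC.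
- by rewrite mulmxDl bp btp.
- by rewrite mulmxDr pb pbt.
have [||||c2 h2] := scal ('i *: (b - adj b)).
- by apply: AZ; apply: subspaceB => //; apply: Aadj.
- by rewrite adjZ adjB adjK conjCi scaleNr -scalerN opprB.
- by rewrite -scalemxAl mulmxBl bp btp.
- by rewrite -scalemxAr mulmxBr pb pbt.
(* Hermitian parts: [b] is half of [(b + adj b) - 'i *: ('i *: (b - adj b))]. *)
exists (2%:R^-1 * (c1 - 'i * c2)).
rewrite -scalerA scalerBl -h1 -scalerA -h2 scalerA -expr2 sqrCi scaleN1r opprK.
rewrite addrACA subrr addr0 -mulr2n -scaler_nat scalerA mulVf ?scale1r //.
by rewrite pnatr_eq0.
Qed.

Lemma orthoproj_split p : A p -> orthoproj p -> ~ minimal_in p ->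
  exists q, [/\ A q, orthoproj q, q *m p = q & q != 0 /\ q != p].
Proof.
move=> Ap p_proj /(herm_corner Ap p_proj)[h [Ah h_h hp ph h_nscal]].
have [pp p_h] := p_proj; have [A_sub AM Aadj] := A_star.
have h_n := herm_normal h_h.
pose E lam := hfun (fun x => (x == lam)%:R) h.
have pE lam : p *m E lam = E lam *m p by apply: hfun_commute; rewrite ?hp.
have EE lam : E lam *m E lam = E lam.
  rewrite hfunM //; apply: hfun_eq => i.
  by case: eqP => _; rewrite ?mulr1 ?mulr0.
have E_h lam : adj (E lam) = E lam.
  by rewrite adj_hfun; apply: hfun_eq => i; rewrite conjC_nat.
have hE lam : h *m E lam = lam *: E lam.
  rewrite -[X in X *m _](hfun_id h_n) hfunM // hfunZ; apply: hfun_eq => i.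
  by case: eqP => [->|_]; rewrite ?mulr0.
(* Without a proper subprojection each [E lam *m p] is 0 or [p]; the value [p] would give
   [h = lam *: p], so all vanish. *)
apply: NNPP => no_q.
have Ep lam : E lam *m p = 0.
  apply/eqP/negPn/negP => Ep0; apply: no_q; exists (E lam *m p).
  split; last split=> //.
  - by apply: (AM) => //; apply: hfun_closed_unital.
  - split; last by rewrite adjM E_h p_h pE.
    by rewrite mulmxA -(mulmxA _ p) pE mulmxA EE -mulmxA pp.
  - by rewrite -mulmxA pp.
  apply/eqP => Epp; apply: (h_nscal lam).
  by rewrite -hp -{1}Epp mulmxA hE -scalemxAl Epp.
(* Summing over the spectrum then gives [p = 0], so [h = 0] is a multiple of [p] after all. *)
pose s := undup [seq spectral_diag h 0 i | i <- enum 'I_n].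
have sumE : \sum_(lam <- s) E lam = 1%:M.
  rewrite hfun_sum // -(hfun1 h); apply: hfun_eq => i.
  rewrite (bigD1_seq (spectral_diag h 0 i)) ?undup_uniq //=; last first.
    by rewrite mem_undup map_f ?mem_enum.
  by rewrite eqxx big1 ?addr0 // => lam; rewrite eq_sym => /negPf ->.
apply: (h_nscal 0); rewrite scale0r -hp -[p]mul1mx -sumE mulmx_suml.
by rewrite big1 ?mulmx0.
Qed.

(** Induction on the rank: a projection that is not minimal splits into two orthogonal ones of
    smaller rank. *)
Lemma orthoproj_decomp p : A p -> orthoproj p -> exists ps : seq M,
  [/\ \sum_(q <- ps) q = p, pairwise (fun q q' => q *m q' == 0) ps &
   forall q, q \in ps ->
     [/\ A q, orthoproj q, q != 0, minimal_in q & q *m p = q]].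
Proof.
have [k] := ubnP (\rank p); elim: k p => // k IHk p rk_p Ap p_proj.
have [pp p_h] := p_proj; have [A_sub _ _] := A_star.
have [p0|p_neq0] := eqVneq p 0; first by exists [::]; rewrite big_nil p0.
have [p_min|p_nmin] := classic (minimal_in p).
  exists [:: p]; split=> //; first by rewrite big_seq1.
  by move=> q; rewrite inE => /eqP ->.
have [q [Aq q_proj qp [q_neq0 qNp]]] := orthoproj_split Ap p_proj p_nmin.
have [qq q_h] := q_proj.
have pq : p *m q = q by rewrite -{1}p_h -{1}q_h -adjM qp.
have Ar : A (p - q) by apply: subspaceB.
have rp : (p - q) *m p = p - q by rewrite mulmxBl pp qp.
have pr : p *m (p - q) = p - q by rewrite mulmxBr pp pq.
have rr : (p - q) *m (p - q) = p - q.
  by rewrite mulmxBl pr mulmxBr qp qq subrr subr0.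
have r_proj : orthoproj (p - q) by split; rewrite // adjB p_h q_h.
have [|ps [sum_ps pw_ps psP]] := IHk q _ Aq q_proj.
  by rewrite -ltnS (leq_trans _ rk_p) // ltnS orthoproj_rank_lt.
have [|rs [sum_rs pw_rs rsP]] := IHk (p - q) _ Ar r_proj.
  rewrite -ltnS (leq_trans _ rk_p) // ltnS orthoproj_rank_lt //.
  by rewrite -subr_eq0 addrC addKr oppr_eq0.
exists (ps ++ rs); split; first by rewrite big_cat /= sum_ps sum_rs addrC subrK.
- rewrite pairwise_cat pw_ps pw_rs !andbT; apply/allrelP => x y x_ps y_rs.
  have [_ _ _ _ xq] := psP _ x_ps; have [_ [_ y_h] _ _ yr] := rsP _ y_rs.
  have ry : (p - q) *m y = y by rewrite -{1}y_h -{1}r_proj.2 -adjM yr.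
  by rewrite -xq -ry mulmxA -(mulmxA x) mulmxBr qp qq subrr mulmx0 mul0mx.
- move=> x; rewrite mem_cat => /orP[/psP|/rsP] [Ax x_proj x0 x_min xE].
    by split=> //; rewrite -xE -mulmxA qp.
  by split=> //; rewrite -xE -mulmxA rp.
Qed.

Lemma minimal_orthoprojs : exists (r : nat) (P : 'I_r -> M),
  [/\ forall i, [/\ A (P i), orthoproj (P i), P i != 0 & minimal_in (P i)],
      forall i j, i != j -> P i *m P j = 0
    & \sum_i P i = 1%:M].
Proof.
have [|ps [sum_ps /(pairwiseP 0) pw_ps psP]] := orthoproj_decomp A1.
  by split; rewrite ?mulmx1 ?adj1.
exists (size ps), (fun i => ps`_i); split.
- by move=> i; have [] := psP ps`_i (mem_nth _ (ltn_ord i)).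
- move=> i j; have h l : adj ps`_(l : 'I_(size ps)) = ps`_l.
    by have [_ []] := psP ps`_l (mem_nth _ (ltn_ord l)).
  rewrite -val_eqE neq_ltn => /orP[ij|ji].
    by apply/eqP/pw_ps; rewrite ?inE.
  (* [pairwise] records one order of the factors; the other comes from adjoints. *)
  have ji0 : ps`_j *m ps`_i = 0 by apply/eqP/pw_ps; rewrite ?inE.
  by rewrite -(h i) -(h j) -adjM ji0 adj0.
- by rewrite -sum_ps (big_nth 0) big_mkord.
Qed.

Lemma orthoproj_isometry p : orthoproj p ->
  exists W : 'M[C]_(\rank p, n), W *m W ^t* = 1%:M /\ W ^t* *m W = p.
Proof.
move=> [pp p_h]; pose W := schmidt (row_base p).
have WW : W *m W ^t* = 1%:M.
  by apply/unitarymxP/schmidt_unitarymx/rank_leq_col.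
have Wp : (W :=: p)%MS.
  exact: eqmx_trans (eqmx_schmidt_free (row_base_free p)) (eq_row_base p).
exists W; split=> //.
have /submxP[x Wx] : (W <= p)%MS by rewrite Wp.
have /submxP[y py] : (p <= W)%MS by rewrite Wp.
have WpW : W *m p = W by rewrite Wx -mulmxA pp.
have : p *m (W ^t* *m W) = p by rewrite {1}py mulmxA -(mulmxA y) WW mulmx1 -py.
move/(congr1 (@adj C n)); rewrite adjM p_h /adj trmxC_mul trmxCK.
by rewrite -mulmxA WpW.
Qed.

(** For [x = p *m a *m q], minimality of [p] makes [x *m adj x] a positive multiple of [p], so [x]
    rescales to a partial isometry [v]. Then [adj v *m v] is a nonzero idempotent multiple of [q],
    that is, [q]. *)
Lemma minimal_link p q a : A p -> A q -> orthoproj p -> orthoproj q ->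
  minimal_in p -> minimal_in q -> A a -> p *m a *m q != 0 ->
  exists v, [/\ A v, v *m adj v = p & adj v *m v = q].
Proof.
move=> Ap Aq p_proj q_proj p_min q_min Aa; set x := _ *m q => x0.
have [pp p_h] := p_proj; have [qq q_h] := q_proj.
have [[_ _ AZ] AM Aadj] := A_star.
have Ax : A x by apply: (AM) => //; apply: (AM).
have px : p *m x = x by rewrite /x !mulmxA pp.
have xq : x *m q = x by rewrite /x -mulmxA qq.
have p0 : p != 0 by apply: contra_neq x0 => p0; rewrite /x p0 !mul0mx.
have [c xc] : exists c, x *m adj x = c *: p.
  have [c cE] := p_min (x *m adj x) (AM _ _ Ax (Aadj _ Ax)); exists c.
  have xtp : adj x *m p = adj x by rewrite -{1}p_h -adjM px.
  by rewrite -cE mulmxA px -mulmxA xtp.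
have c_gt0 : 0 < c.
  have := mxtrace_mul_adj_gt0 x0; rewrite xc linearZ /= pmulr_lgt0 //.
  exact: orthoproj_trace_gt0.
pose v := (sqrtC c)^-1 *: x.
have Av : A v by apply: AZ.
have pv : p *m v = v by rewrite -scalemxAr px.
have vq : v *m q = v by rewrite -scalemxAl xq.
have vv : v *m adj v = p.
  rewrite adjZ -scalemxAl -scalemxAr scalerA xc scalerA geC0_conj; last first.
    by rewrite invr_ge0 sqrtC_ge0 ltW.
  by rewrite -invfM -expr2 sqrtCK mulVf ?scale1r // gt_eqF.
exists v; split=> //.
have [c' vc'] : exists c', adj v *m v = c' *: q.
  have [c' cE] := q_min (adj v *m v) (AM _ _ (Aadj _ Av) Av); exists c'.
  have qvt : q *m adj v = adj v by rewrite -{1}q_h -adjM vq.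
  by rewrite -cE mulmxA qvt -mulmxA vq.
have vvvv : adj v *m v *m (adj v *m v) = adj v *m v.
  by rewrite mulmxA -(mulmxA (adj v)) vv -mulmxA pv.
have tr_neq0 : \tr (adj v *m v) != 0.
  by rewrite mxtrace_mulC vv gt_eqF // orthoproj_trace_gt0.
have c'0 : c' != 0.
  by apply: contra_neq tr_neq0 => c'0; rewrite vc' c'0 scale0r mxtrace0.
have q0 : q != 0.
  by apply: contra_neq tr_neq0 => q0; rewrite vc' q0 scaler0 mxtrace0.
move: vvvv; rewrite vc' -scalemxAl -scalemxAr qq scalerA => /eqP.
rewrite -subr_eq0 -scalerBl scaler_eq0 (negPf q0) orbF subr_eq0 => /eqP.
by rewrite -[RHS]mulr1 => /(mulfI c'0) ->; rewrite scale1r.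
Qed.

End MinimalProjections.

(** * Wedderburn decomposition of a unital star algebra *)

Section Wedderburn.
Variables (C : numClosedFieldType) (n : nat).
Local Notation M := 'M[C]_n.

Lemma orthonormal_basis_enum (T : finType) (g : T -> 'rV[C]_n) :
  (forall x y, g x *m (g y) ^t* = (x == y)%:R%:M) ->
  \sum_x (g x) ^t* *m g x = 1%:M ->
  exists (e : 'I_n -> T) (U : M), [/\ bijective e, U \is unitarymx
    & forall X p q, (U ^t* *m X *m U) p q =
                    (g (e p) *m X *m (g (e q)) ^t*) 0 0].
Proof.
move=> g_orth g_full.
have row_conj m (h : 'I_m -> 'rV[C]_n) (X : M) p q :
    ((\matrix_t h t) *m X *m (\matrix_t h t) ^t*) p q =
    (h p *m X *m (h q) ^t*) 0 0.
  rewrite -[h p in RHS](rowK h) -[h q in RHS](rowK h) -row_mul.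
  by rewrite [LHS]mxE [RHS]mxE; apply: eq_bigr => j _; rewrite !mxE.
(* Both cardinals are traces of identity matrices, [G *m G ^t*] and [G ^t* *m G], which agree by
   cyclicity. *)
have cardT : n = #|T|.
  pose G : 'M[C]_(#|T|, n) := \matrix_t g (enum_val t).
  have GG : G *m G ^t* = 1%:M.
    apply/matrixP => i j; rewrite -[X in X *m _]mulmx1.
    rewrite (row_conj _ (fun t => g (enum_val t))) mulmx1 g_orth.
    by rewrite !mxE (inj_eq enum_val_inj) eqxx mulr1n.
  have GtG : G ^t* *m G = 1%:M.
    rewrite -g_full (eq_bigl (fun x => x \in T)) // big_enum_val /=.
    apply/matrixP => i j; rewrite mxE summxE; apply: eq_bigr => t _.
    by rewrite !mxE big_ord1 !mxE.
  apply/eqP; rewrite -(eqr_nat C) -[n%:R]mxtrace_scalar -[_%:R]mxtrace_scalar.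
  by rewrite -GG -GtG mxtrace_mulC.
pose e (p : 'I_n) : T := enum_val (cast_ord cardT p).
have e_bij : bijective e.
  exists (fun x => cast_ord (esym cardT) (enum_rank x)) => [p|x].
  - by rewrite /e enum_valK cast_ordK.
  - by rewrite /e cast_ordKV enum_rankK.
exists e, ((\matrix_p g (e p)) ^t*); split=> //.
- rewrite trmxC_unitary; apply/unitarymxP/matrixP => p q.
  rewrite -[X in X *m _]mulmx1 row_conj mulmx1 g_orth.
  by rewrite !mxE (inj_eq (bij_inj e_bij)) eqxx mulr1n.
- by move=> X p q; rewrite trmxCK row_conj.
Qed.

Variable A : mxset C n.
Hypotheses (A_star : star_algebra A) (A1 : A 1%:M).

(* Equivalent minimal projections carry partial isometries in [A] to a common
   representative; transporting an orthonormal basis of the range of the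
   representative along them gives the basis of a Wedderburn decomposition. The
   blocks are indexed by all minimal projections: those which are not
   representatives yield empty blocks. *)
Lemma wedderburn :
  exists (k : nat) (s f : 'I_k -> nat)
         (e : 'I_n -> {l : 'I_k & ('I_(s l) * 'I_(f l))%type}) (U : M),
    [/\ bijective e, U \is unitarymx
      & forall X, A X <-> exists B, X = U *m blockI e B *m U ^t*].
Proof.
have [r [P [PP P_orth sumP]]] := minimal_orthoprojs A_star A1.
have [[A0 AD AZ] AM Aadj] := A_star.
have AP i : A (P i) by case: (PP i).
have P_proj i : orthoproj (P i) by case: (PP i).
have Pp i : P i *m P i = P i by case: (P_proj i).
have P_h i : adj (P i) = P i by case: (P_proj i).
have P_neq0 i : P i != 0 by case: (PP i).
have P_min i : minimal_in A (P i) by case: (PP i).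
pose link i j := exists a, A a /\ P i *m a *m P j != 0.
have linkP i j : link i j ->
    exists v, [/\ A v, v *m adj v = P i & adj v *m v = P j].
  by case=> a [Aa a_neq0]; apply: minimal_link a_neq0.
have link_refl i : link i i by exists 1%:M; rewrite mulmx1 Pp.
have link_sym i j : link i j -> link j i.
  case=> a [Aa a_neq0]; exists (adj a); split; first exact: Aadj.
  apply: contra_neq a_neq0 => a0; apply: (can_inj (@adjK _ _)).
  by rewrite !adjM !P_h mulmxA a0 adj0.
have link_trans i j l : link i j -> link j l -> link i l.
  move=> /linkP[v [Av vv vtv]] /linkP[w [Aw ww wtw]].
  exists (v *m w); split; first exact: AM.
  have Pv : P i *m v = v by apply: partial_isometry_range.
  have wP : w *m P l = w.
    by rewrite -wtw mulmxA ww; apply: partial_isometry_range.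
  rewrite mulmxA Pv -mulmxA wP; apply: contra_neq (P_neq0 i) => vw0.
  move/(congr1 (mulmxr (adj w *m adj v))): vw0.
  by rewrite /= mul0mx mulmxA -(mulmxA v) ww -vtv !mulmxA vv -mulmxA vv Pp.
pose linkb i j : bool := excluded_middle_informative (link i j).
have linkbP i j : reflect (link i j) (linkb i j).
  by rewrite /linkb; case: excluded_middle_informative => ?; constructor.
(* A choice that depends only on the class of [i], as linked indices have the same [pick]. *)
pose rep i := odflt i [pick j | linkb i j].
have link_rep i : link i (rep i).
  by rewrite /rep; case: pickP => [j /linkbP|_]; last exact: link_refl.
have rep_eq i j : link i j -> rep i = rep j.
  move=> ij; rewrite /rep.
  have -> : [pick l | linkb i l] = [pick l | linkb j l].
    apply: eq_pick => l; apply/linkbP/linkbP; last exact: link_trans.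
    exact/link_trans/link_sym.
  by case: pickP => // /(_ j)/linkbP; case.
have repK i : rep (rep i) = rep i by apply/esym/rep_eq.
have /fin_all_exists[v vP] : forall i,
    exists v, [/\ A v, v *m adj v = P (rep i) & adj v *m v = P i].
  by move=> i; apply/linkP/link_sym.
have /fin_all_exists[W WP] : forall i, exists W : 'M[C]_(\rank (P i), n),
    W *m W ^t* = 1%:M /\ W ^t* *m W = P i.
  by move=> i; apply: orthoproj_isometry.
have Av i : A (v i) by case: (vP i).
have vvt i : v i *m adj (v i) = P (rep i) by case: (vP i).
have vtv i : adj (v i) *m v i = P i by case: (vP i).
have WW l : W l *m (W l) ^t* = 1%:M by case: (WP l).
have WtW l : (W l) ^t* *m W l = P l by case: (WP l).
have WPr l : W l *m P l = W l by rewrite -[RHS]mul1mx -(WW l) -mulmxA WtW.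
have Pvl i : P (rep i) *m v i = v i by apply: partial_isometry_range.
have vPr i : v i *m P i = v i by rewrite -vtv mulmxA vvt.
have vv i j : v i *m adj (v j) = (i == j)%:R *: P (rep i).
  have [<-|ij] := eqVneq; first by rewrite scale1r vvt.
  rewrite scale0r -(vPr i) -(vPr j) adjM P_h mulmxA -(mulmxA _ (P i)).
  by rewrite P_orth // mulmx0 mul0mx.
pose cl l := [pred i | rep i == l].
pose idx l (m : nat) : 'I_r := nth l (enum (cl l)) m.
(* The inverse of [idx] within a class. The first factor counts the members of a class, the second
   is the range of its representative. *)
pose pos i : nat := index i (enum (cl (rep i))).
pose s l := #|cl l|; pose f l := \rank (P l).
have idx_rep l (a : 'I_(s l)) : rep (idx l a) = l.
  have : idx l a \in enum (cl l) by apply: mem_nth; rewrite -cardE.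
  by rewrite mem_enum inE => /eqP.
have idxK l (a : 'I_(s l)) : pos (idx l a) = a.
  by rewrite /pos idx_rep index_uniq ?enum_uniq // -cardE.
pose g (x : {l : 'I_r & ('I_(s l) * 'I_(f l))%type}) : 'rV[C]_n :=
  row (tagged x).2 (W (tag x)) *m v (idx (tag x) (tagged x).1).
have gXg l (a : 'I_(s l)) (b : 'I_(f l)) l' (a' : 'I_(s l')) (b' : 'I_(f l'))
    (X : M) : (g (Tagged _ (a, b)) *m X *m (g (Tagged _ (a', b'))) ^t*) =
    ((W l *m (v (idx l a) *m X *m adj (v (idx l' a'))) *m (W l') ^t*) b b')%:M.
  rewrite /g /= trmxC_mul; apply/matrixP => i j; rewrite !ord1 [RHS]mxE mulr1n.
  rewrite !mulmxA -!row_mul /adj [LHS]mxE [LHS]mxE [RHS]mxE.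
  by apply: eq_bigr => t _; rewrite !mxE.
have [||e [U [e_bij U_u UP]]] := @orthonormal_basis_enum _ g.
- move=> [l [a b]] [l' [a' b']].
  rewrite -[g (Tagged _ (a, b))]mulmx1 gXg mulmx1.
  congr (_ %:M); rewrite vv; have [ll'|ll'] := eqVneq l l'.
    case: _ / ll' in a' b' *; rewrite idx_rep -scalemxAr -scalemxAl WPr WW.
    rewrite !mxE eq_Tagged /= xpair_eqE -natrM mulnb.
    congr ((_ && _)%:R); apply/eqP/eqP => [|-> //].
    by move=> /(congr1 pos); rewrite !idxK => /val_inj.
  rewrite [_ == idx l' a'](_ : _ = false) ?scale0r ?mulmx0 ?mul0mx ?mxE.
    suff /negPf -> : Tagged (fun l => 'I_(s l) * 'I_(f l))%type (a, b) !=
      Tagged (fun l => 'I_(s l) * 'I_(f l))%type (a', b') by [].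
    by apply: contra_neq ll' => /(congr1 tag).
  by apply/negbTE; apply: contra_neq ll' => /(congr1 rep); rewrite !idx_rep.
- transitivity (\sum_l \sum_(x : 'I_(s l) * 'I_(f l))
      (g (Tagged _ x)) ^t* *m g (Tagged _ x)).
    by rewrite sig_big_dep; apply: eq_bigr => -[l x] _.
  rewrite -sumP [RHS](partition_big rep xpredT) //=; apply: eq_bigr => l _.
  transitivity (\sum_(a < s l) \sum_(b < f l)
      (g (Tagged _ (a, b))) ^t* *m g (Tagged _ (a, b))).
    by rewrite pair_bigA; apply: eq_bigr => -[a b] _.
  transitivity (\sum_(i in cl l) P i); last by apply: eq_bigl.
  rewrite [RHS]big_enum_val; apply: eq_bigr => a _.
  rewrite (enum_val_nth l) -/(idx l a).
  transitivity (adj (v (idx l a)) *m (\sum_b (row b (W l)) ^t* *m row b (W l))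
                  *m v (idx l a)).
    rewrite mulmx_sumr mulmx_suml; apply: eq_bigr => b _.
    by rewrite /g /= trmxC_mul !mulmxA.
  have -> : \sum_b (row b (W l)) ^t* *m row b (W l) = P l.
    rewrite -[RHS]WtW; apply/matrixP => i j; rewrite summxE [RHS]mxE.
    by apply: eq_bigr => b _; rewrite mxE big_ord1 !mxE.
  by have := Pvl (idx l a); rewrite idx_rep -mulmxA => ->; rewrite vtv.
exists r, s, f, e, U; split=> // X; split=> [AX|[B XE]].
  (* The compression of [X] lies in the corner of [P l], so it is a scalar multiple of [P l]; traces
     recover the scalar. *)
  pose B l (m m' : nat) : C :=
    \tr (v (idx l m) *m X *m adj (v (idx l m'))) / \tr (P l).
  exists B; rewrite -[LHS](unitary_conjK _ U_u); congr (_ *m _ *m _).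
  apply/matrixP => p q; rewrite UP [RHS]mxE.
  case: (e p) (e q) => [l [a b]] [l' [a' b']].
  rewrite gXg [LHS]mxE eqxx mulr1n /=.
  set i := idx l a; set j := idx l' a'; set Z := v i *m X *m adj (v j).
  have AZ' : A Z by apply: (AM); [apply: (AM)|apply: Aadj].
  have PZ : P l *m Z *m P l' = Z.
    rewrite -(idx_rep _ a) -(idx_rep _ a') -/i -/j /Z !mulmxA Pvl -!mulmxA.
    by rewrite -[P (rep j)]P_h -adjM Pvl.
  case: eqP => [ll'|ll'].
    case: _ / ll' in a' b' j Z AZ' PZ *.
    have [c Zc] := P_min l _ AZ'; rewrite PZ in Zc.
    have -> : B l a a' = c.
      rewrite /B -/i -/j -/Z Zc linearZ /= mulfK //.
      by rewrite gt_eqF // orthoproj_trace_gt0.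
    rewrite Zc -scalemxAr -scalemxAl WPr WW !mxE.
    by rewrite -val_eqE.
  (* A nonzero [Z] would link the representatives of two different classes. *)
  suff -> : Z = 0 by rewrite mulmx0 mul0mx mxE.
  apply/eqP/negPn/negP => Z0; apply: ll'.
  rewrite -(idx_rep _ a) -(idx_rep _ a') -/i -/j -(repK i) -(repK j) !idx_rep.
  by apply: rep_eq; exists Z; rewrite PZ.
(* The products [adj (v i) *m v j] within a class are the matrix units of [A]; [X'] is assembled
   from them with the given coefficients. *)
pose X' := \sum_i \sum_(j | rep j == rep i)
  B (rep i) (pos i) (pos j) *: (adj (v i) *m v j).
have AX' : A X'.
  rewrite /X'; elim/big_ind: _ => // i _; elim/big_ind: _ => // j _.
  by apply: AZ; apply: AM => //; apply: Aadj.
suff -> : X = X' by [].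
rewrite XE -[RHS](unitary_conjK _ U_u); congr (_ *m _ *m _).
apply/matrixP => p q; rewrite UP [LHS]mxE.
case: (e p) (e q) => [l [a b]] [l' [a' b']].
rewrite gXg [RHS]mxE eqxx mulr1n /=.
set i := idx l a; set j := idx l' a'.
have -> : v i *m X' *m adj (v j) =
    (if l' == l then B l a a' else 0) *: P l.
  rewrite /X' mulmx_sumr mulmx_suml (bigD1 i) //=.
  rewrite [X in _ + X]big1 ?addr0 => [|i' i'i]; last first.
    rewrite mulmx_sumr big1 ?mul0mx // => j' _.
    by rewrite -scalemxAr mulmxA vv eq_sym (negPf i'i) scale0r mul0mx scaler0.
  have vvv c j' : v i *m (c *: (adj (v i) *m v j')) *m adj (v j) =
      (c * (j' == j)%:R) *: (P (rep i) *m P (rep j')).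
    rewrite -scalemxAr -scalemxAl mulmxA vvt -mulmxA vv -scalemxAr.
    by rewrite scalerA.
  rewrite mulmx_sumr mulmx_suml.
  have rep_i : rep i = l by apply: idx_rep.
  have rep_j : rep j = l' by apply: idx_rep.
  rewrite rep_i; have [ll'|ll'] := eqVneq l' l.
    rewrite (bigD1 j) /= ?rep_j ?ll' //.
    rewrite big1 ?addr0 => [|j' /andP[_ /negPf j'j]].
      have PE : P l' = P l by rewrite ll'.
      by rewrite vvv eqxx mulr1 rep_i rep_j PE Pp /i /j !idxK.
    by rewrite vvv j'j mulr0 scale0r.
  rewrite scale0r big1 // => j' /eqP j'l; rewrite vvv.
  have /negPf -> : j' != j by apply: contra_neq ll' => j'j; rewrite -rep_j -j'j.
  by rewrite mulr0 scale0r.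
rewrite eq_sym; have [ll'|ll'] := eqVneq l' l; last first.
  by rewrite scale0r mulmx0 mul0mx mxE.
case: _ / ll' in b a i *.
by rewrite -scalemxAr -scalemxAl WPr WW !mxE -val_eqE.
Qed.

Lemma commutant_compatible (sigma : M) :
  commutant A sigma -> compatible sigma A.
Proof.
move=> c_sigma; have [k [s [f [e [U [e_bij U_u AP]]]]]] := wedderburn.
exists k, s, f, e, U; split=> //.
have [B|Ts sE] := blockI_commutant e_bij (Y := U ^t* *m sigma *m U); last first.
  by exists (@block_id C k), Ts; rewrite -sE unitary_conjK.
have /c_sigma : A (U *m blockI e B *m U ^t*) by apply/AP; exists B.
rewrite -[sigma in sigma *m _](unitary_conjK _ U_u).
rewrite -[sigma in _ = _ *m sigma](unitary_conjK _ U_u).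
rewrite !mulmx_unitary_conj // => /(congr1 (fun Z => U ^t* *m Z *m U)).
by rewrite !unitary_conjVK.
Qed.

End Wedderburn.

(** * Compatibility of [sigma] and assembly of the four claims *)

Lemma commutant_distorted (C : numClosedFieldType) (n : nat)
    (Vs : mxset C n) (sigma : 'M[C]_n) :
  posdef sigma -> commutant Vs sigma ->
  commutant (alg (Drho_inv_set sigma Vs)) sigma.
Proof.
move=> s_pd cs Y aY.
have [S_pd SS] := sqrtmP s_pd; set S := sqrtm sigma in S_pd SS.
have S_unit := posdef_unit S_pd.
(* Both sides equal [S]. *)
have sSV : sigma *m invmx S = invmx S *m sigma.
  by rewrite -SS mulmxK // mulKmx.
apply: (aY (fun Y => sigma *m Y = Y *m sigma)) => [|_ [X VsX ->]].
  split; first split=> [|X Z sX sZ|a X sX].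
  - by rewrite mulmx0 mul0mx.
  - by rewrite mulmxDl mulmxDr sX sZ.
  - by rewrite -scalemxAl -scalemxAr sX.
  - by move=> X Z sX sZ; rewrite mulmxA sX -mulmxA sZ mulmxA.
  - move=> X sX; apply: (can_inj (@adjK _ _)).
    by rewrite !adjM adjK s_pd.1 sX.
by rewrite /Drho_inv -/S !mulmxA sSV -(mulmxA _ sigma) cs // -!mulmxA sSV.
Qed.

Theorem mainTheorem8 (R : realType) (n : nat)
    (Vs : mxset R[i] n) (V : 'M[R[i]]_n) :
  subspace Vs -> Vs V -> posdef V ->
  let sigma := HSproj (center (alg Vs)) V in
  [/\ posdef sigma,
      mxsubset Vs (alg_rho sigma Vs),
      compatible sigma (alg (Drho_inv_set sigma Vs))
    & forall rho : 'M[R[i]]_n, posdef rho ->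
        compatible rho (alg (Drho_inv_set rho Vs)) ->
        mxsubset (alg_rho sigma Vs) (alg_rho rho Vs)].
Proof.
move=> _ VsV V_pd sigma.
have s_pd : posdef sigma by apply: HSproj_center_posdef.
split=> //; first by move=> X VsX D _; apply.
  have [S_pd _] := sqrtmP s_pd; set S := sqrtm sigma in S_pd.
  have S_unit := posdef_unit S_pd.
  have SV_h : adj (invmx S) = invmx S by rewrite adj_invmx S_pd.1.
  have a_star := alg_star (Drho_inv_set sigma Vs).
  apply: commutant_compatible => //.
    (* The distorted [V] is an invertible hermitian element, which makes the algebra unital. *)
    apply: (@star_algebra_unital _ _ _ a_star (Drho_inv sigma V)).
    - by rewrite /Drho_inv -/S !adjM SV_h V_pd.1 mulmxA.
    - by rewrite !unitmx_mul unitmx_inv S_unit posdef_unit.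
    - by apply: sub_alg; exists V.
  apply: commutant_distorted => // X VsX.
  have [[_ cs] _] := HSproj_center (alg_star Vs) (sub_alg VsV).
  by apply: cs; apply: sub_alg.
by move=> rho rho_pd rho_comp; apply: alg_sigma_minimal.
Qed.
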